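(* Let $h\in H$, let $f(z)=\sum_{n=0}^{+\infty}a_nz^n$ be analytic in the unit disc $\mathbb{D}$ and not identically zero, and let $(\theta_n)_{n\ge 0}$ be a sequence of positive integers such that, for some $\varphi\in\mathcal{L}$, $$\frac{\theta_{n+1}}{\theta_n}\ge 1+\frac{1}{\varphi(n)}\qquad(n\ge 0),$$ and $$\gamma(\varphi)=\varlimsup_{n\to+\infty}\frac{1}{\ln n}\ln\frac{\theta_n}{\theta_{n+1}-\theta_n}\le\delta,\qquad \delta\in[0,1/2).$$ For $t\in\mathbb{R}$ put $f_t(z)=\sum_{n=0}^{+\infty}a_ne^{i\theta_nt}z^n$. Then for almost every $t\in\mathbb{R}$ (with respect to Lebesgue measure) there exists a measurable set $E=E(\delta,t)\subset(0,1)$ with $\int_E h(r)\,dr<+\infty$ such that $$\varlimsup_{r\to1-0,\ r\notin E}\ \frac{\ln M_f(r,t)-\ln\mu_f(r)}{2\ln h(r)+\ln\ln\{h(r)\mu_f(r)\}}\le\frac{1+3\delta}{4+2\delta}.$$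
   Context: $H$ is the class of positive continuous functions $h$ on $(0,1)$ increasing to $+\infty$ (as $r\to1-0$) such that $\int_{r_0}^1h(r)\,dr=+\infty$ for $r_0\in(0,1)$. $\mathcal{L}$ is the class of (nonnegative) functions $l$ on $[0,+\infty)$ increasing to $+\infty$; for $l\in\mathcal{L}$, $\gamma(l)=\varlimsup_{x\to+\infty}\frac{\ln l(x)}{\ln x}$. The condition involving $1/\varphi(n)$ presupposes $\varphi(n)>0$ for all integers $n\ge0$. For $r\in(0,1)$: $\mu_f(r)=\max\{|a_n|r^n: n\ge0\}$ and $M_f(r,t)=\max\{|f_t(z)|:|z|=r\}$. *)

(* Defs.v *)
From HB Require Import structures.
From mathcomp Require Import all_boot all_order all_algebra.
From mathcomp Require Import all_classical all_reals all_analysis.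
From mathcomp Require Import complex.

Set Implicit Arguments.
Unset Strict Implicit.
Unset Printing Implicit Defensive.

Import Order.TTheory GRing.Theory Num.Theory numFieldNormedType.Exports.

Local Open Scope classical_set_scope.
Local Open Scope complex_scope.
Local Open Scope ring_scope.

(* On R[i] the norm of ssrnum is R[i]-valued (with zero imaginary part). *)
Definition cmod (R : realType) (z : R[i]) : R := complex.Re `|z|.

Definition expi (R : realType) (x : R) : R[i] := cos x +i* sin x.

(* The topology of the complex plane is carried by the alias R[i]^o. *)
Definition power_terms (R : realType) (a : nat -> R[i]) (z : R[i]) :
  nat -> R[i]^o := fun n => a n * z ^+ n.

(* Analyticity in the open unit disc as pointwise convergence there of the
   power series with coefficients a to f. *)
Definition disc_analytic (R : realType) (a : nat -> R[i]) (f : R[i] -> R[i]) :=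
  forall z : R[i], cmod z < 1 ->
    series (power_terms a z) @ \oo --> (f z : R[i]^o).

Definition rotated_coef (R : realType) (a : nat -> R[i]) (theta : nat -> nat)
  (t : R) : nat -> R[i] := fun n => a n * expi ((theta n)%:R * t).

Definition rotated_sum (R : realType) (a : nat -> R[i]) (theta : nat -> nat)
  (t : R) (z : R[i]) : R[i] :=
  limn (series (power_terms (rotated_coef a theta t) z)).

(* If sum a_n z^n converges in the unit disc, then for 0 < r < 1 the suprema
   in max_term and max_modulus are attained, i.e. they are maxima: a_n r^n
   tends to 0, and the rotated sum is continuous on the circle of radius r. *)
Definition max_term (R : realType) (a : nat -> R[i]) (r : R) : R :=
  sup (range (fun n => cmod (a n) * r ^+ n)).

Definition max_modulus (R : realType) (a : nat -> R[i]) (theta : nat -> nat)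
  (r t : R) : R :=
  sup [set cmod (rotated_sum a theta t z) | z in [set z | cmod z = r]].

(* "Increasing" is read in the wide sense (nondecreasing) in both classes;
   values outside ]0, 1[, resp. [0, +oo[, are irrelevant. *)
Definition class_H (R : realType) (h : R -> R) : Prop :=
  [/\ {in `]0, 1[, forall r, 0 < h r},
      {in `]0, 1[, continuous h},
      {in `]0, 1[ &, {homo h : x y / x <= y}},
      h r @[r --> 1^'-] --> +oo &
      {in `]0, 1[, forall r0 : R,
        (\int[lebesgue_measure]_(r in `]r0, 1%R[) (h r)%:E = +oo)%E}].

Definition class_L (R : realType) (l : R -> R) : Prop :=
  [/\ {in `[0, +oo[, forall x, 0 <= l x},
      {in `[0, +oo[ &, {homo l : x y / x <= y}} &
      l x @[x --> +oo] --> +oo].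

Definition gamma (R : realType) (l : R -> R) : \bar R :=
  limf_esup (fun x => (ln (l x) / ln x)%:E) (pinfty_nbhs R).

(* Main.v *)
Require Import Defs.
From HB Require Import structures.
From mathcomp Require Import all_boot all_order all_algebra.
From mathcomp Require Import all_classical all_reals all_analysis.
From mathcomp Require Import measurable_realfun complex.
From mathcomp Require Import ring lra zify.

Set Implicit Arguments.
Unset Strict Implicit.
Unset Printing Implicit Defensive.

Import Order.TTheory GRing.Theory Num.Theory numFieldNormedType.Exports.

Local Open Scope classical_set_scope.
Local Open Scope complex_scope.
Local Open Scope ring_scope.

(** Write [M], [mu], [F = sum c_n r^n] (with [c_n = |a_n|], up to the constant term),
    [A] and [V] for the maximum modulus, the maximal term, the majorant, and the mean
    and variance of the law with weights [c_n r^n / F].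

    Off a set of finite h-measure, [(ln F)' <= h u ln^2 u] with [u = e + ln F], and
    likewise for [A' = V / r]; together with Chebyshev's inequality
    [F <= C mu sqrt (1 + V)] this gives [A <= B^(1 + o(1))] and [V <= B^(1 + o(1))],
    where [B = h^2 ln (h mu)].

    Cut the frequencies in dyadic blocks and each block in residue classes modulo
    [K ~ phi], in which [theta] at least doubles. For such a class with energy S the
    exponential moment of [T / (2 sqrt S)], T being the real part of the class sum, is
    bounded by comparison with a Riesz product, whose integral over a period is exact.
    By Tonelli in (r, t) and Markov's inequality, for almost every t and all r off a
    set of finite h-measure every class sum is [O (sqrt S (ln h + s))] in block s,
    uniformly on the circle; no discretisation of r is needed, because on the set
    where the weighted sum X of all exponentials exceeds h, the integral of h is at most
    the integral of X. Cauchy-Schwarz over the classes yields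
    [M <= B^o(1) sqrt (mu F (1 + A)^delta)], that is
    [M <= mu B^(1/4 + delta/2 + o(1))], and
    [1/4 + delta/2 <= (1 + 3 delta) / (4 + 2 delta)] for delta in [0, 1/2]. *)

(** * Power series converging in the unit disc *)

(** Radius of convergence at least one, in Abel's form: bounded terms at every smaller radius.
    Boundedness is easy to transfer to derived series, and it is what the supremum in [max_term]
    needs. *)
Definition unit_radius (R : realType) (c : nat -> R) :=
  forall rho, 0 < rho < 1 -> exists C, forall n, `|c n| * rho ^+ n <= C.

(** As [q < 1], each of the [n.+1] copies of [q ^+ n] is at most a term [q ^+ i] with [i <= n] of
    the geometric series. *)
Lemma natmul_expr_le (R : realType) (q : R) n :
  0 <= q < 1 -> n.+1%:R * q ^+ n <= (1 - q)^-1.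
Proof.
move=> /andP[q0 q1]; have q1' : 0 < 1 - q by rewrite subr_gt0.
rewrite -[leRHS]mul1r ler_pdivlMr//.
have -> : n.+1%:R * q ^+ n = \sum_(i < n.+1) q ^+ n.
  by rewrite sumr_const card_ord mulr_natl.
apply: (@le_trans _ _ ((\sum_(i < n.+1) q ^+ i) * (1 - q))).
  rewrite ler_wpM2r ?(ltW q1')//; apply: ler_sum => i _.
  by apply: ler_wiXn2l => //; [exact: ltW|rewrite -ltnS].
have := subrX1 q n.+1; have : 0 <= q ^+ n.+1 by exact: exprn_ge0.
by move=> ? ?; lra.
Qed.

(** The factor [n.+1] is paid for by moving to the larger radius [s] halfway between [rho] and 1:
    [n.+1 * (rho / s) ^+ n] stays bounded. *)
Lemma unit_radius_diffs (R : realType) (c : nat -> R) :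
  unit_radius c -> unit_radius (pseries_diffs c).
Proof.
move=> uc rho /andP[r0 r1].
pose s := (rho + 1) / 2.
have s01 : 0 < s < 1 by apply/andP; split; rewrite /s; lra.
have rs : rho < s by rewrite /s; lra.
have [C hC] := uc s s01; have s0 : 0 < s by case/andP: s01.
exists ((1 - rho / s)^-1 * (C / s)) => n.
rewrite /pseries_diffs normrM normr_nat.
have q01 : 0 <= rho / s < 1.
  by rewrite divr_ge0 ?(ltW r0) ?(ltW s0)//= ltr_pdivrMr ?mul1r.
have -> : n.+1%:R * `|c n.+1| * rho ^+ n =
  (n.+1%:R * (rho / s) ^+ n) * ((`|c n.+1| * s ^+ n.+1) / s).
  rewrite expr_div_n exprS; field.
  by rewrite !lt0r_neq0// exprn_gt0.
apply: ler_pM => //.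
- by rewrite mulr_ge0// exprn_ge0//; case/andP: q01.
- by rewrite divr_ge0 ?(ltW s0)// mulr_ge0// exprn_ge0// ltW.
- exact: natmul_expr_le.
- by rewrite ler_pM2r ?invr_gt0.
Qed.

Lemma unit_radius_cvg (R : realType) (c : nat -> R) (x : R) :
  unit_radius c -> `|x| < 1 -> cvgn (pseries (fun i => `|c i|) `|x|).
Proof.
move=> uc x1.
pose s := (`|x| + 1) / 2.
have x0 : 0 <= `|x| by [].
have s01 : 0 < s < 1 by apply/andP; split; rewrite /s; lra.
have rs : `|x| < s by rewrite /s; lra.
have [C hC] := uc s s01; have s0 : 0 < s by case/andP: s01.
have C0 : 0 <= C by rewrite (le_trans _ (hC 0))// mulr_ge0// exprn_ge0// ltW.
have q0 : 0 <= `|x| / s by rewrite divr_ge0// ltW.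
apply: (@series_le_cvg _ _ (geometric C (`|x| / s))) => [n|n|n|].
- by rewrite mulr_ge0// exprn_ge0.
- by rewrite /geometric /= mulr_ge0// exprn_ge0.
- rewrite /geometric /= expr_div_n mulrCA [leRHS]mulrC.
  by rewrite ler_wpM2r ?exprn_ge0// ler_pdivlMr ?exprn_gt0.
- by apply: is_cvg_geometric_series; rewrite ger0_norm// ltr_pdivrMr// mul1r.
Qed.

Lemma unit_radius_cvg_pseries (R : realType) (c : nat -> R) (x : R) :
  unit_radius c -> `|x| < 1 -> cvgn (pseries c x).
Proof.
move=> uc x1; apply: normed_cvg; rewrite /normed_series_of /=.
rewrite (_ : (fun _ => _) = (fun i => `|c i| * `|x| ^+ i)); last first.
  by apply/funext => i; rewrite normrM normrX.
exact: unit_radius_cvg.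
Qed.

Lemma is_derive_pseries (R : realType) (c : nat -> R) (x : R) :
  unit_radius c -> `|x| < 1 ->
  is_derive x (1 : R) (fun x => limn (pseries c x))
    (limn (pseries (pseries_diffs c) x)).
Proof.
move=> uc x1; pose K := (`|x| + 1) / 2.
have x0 : 0 <= `|x| by [].
have K1 : `|K| < 1 by rewrite ger0_norm /K; lra.
(* Termwise differentiation at [x] requires convergence of the series and of its first two derived
   series at some [K] with [|x| < K]. *)
apply: (@pseries_snd_diffs _ _ K).
- exact: unit_radius_cvg_pseries.
- by apply: unit_radius_cvg_pseries => //; exact: unit_radius_diffs.
- by apply: unit_radius_cvg_pseries => //; do 2 apply: unit_radius_diffs.
- by rewrite [ltRHS]ger0_norm /K; lra.
Qed.

Lemma unit_radius_natmul (R : realType) (c : nat -> R) :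
  unit_radius c -> unit_radius (fun k => k%:R * c k).
Proof.
move=> uc rho r01; have [C hC] := unit_radius_diffs uc r01.
have r0 : 0 <= rho by case/andP: r01 => /ltW.
exists (C * rho) => -[|n].
  rewrite mul0r normr0 mul0r mulr_ge0//; apply: le_trans (hC 0).
  by rewrite mulr_ge0// exprn_ge0.
by rewrite exprSr mulrA; apply: ler_wpM2r => //; exact: hC.
Qed.

Lemma pseries_partial_le (R : realType) (c : nat -> R) (r : R) n :
  (forall k, 0 <= c k) -> unit_radius c -> 0 <= r < 1 ->
  pseries c r n <= limn (pseries c r).
Proof.
move=> c0 uc /andP[r0 r1]; apply: nondecreasing_cvgn_le.
  by apply: nondecreasing_series => k _ _; rewrite mulr_ge0// exprn_ge0.
by apply: unit_radius_cvg_pseries => //; rewrite ger0_norm.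
Qed.

Lemma pseries_sum_ge0 (R : realType) (c : nat -> R) (r : R) :
  (forall k, 0 <= c k) -> unit_radius c -> 0 <= r < 1 ->
  0 <= limn (pseries c r).
Proof.
move=> c0 uc r01; apply: le_trans (pseries_partial_le 0 c0 uc r01).
by rewrite /pseries /series /= big_geq.
Qed.

Lemma pseries_sum_ge1 (R : realType) (c : nat -> R) (r : R) :
  (forall k, 0 <= c k) -> 1 <= c 0 -> unit_radius c -> 0 <= r < 1 ->
  1 <= limn (pseries c r).
Proof.
move=> c0 c01 uc r01; apply: le_trans (pseries_partial_le 1 c0 uc r01).
by rewrite /pseries /series /= big_nat1 expr0 mulr1.
Qed.

(** * The law with weights [c k * r ^+ k]: mean, variance, concentration, moments *)

(** The Euler operator [r d/dr] multiplies the k-th coefficient by [k]. *)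
Lemma pseries_natmul_sum (R : realType) (c : nat -> R) (r : R) :
  unit_radius c -> `|r| < 1 ->
  limn (pseries (fun k => k%:R * c k) r) =
    r * limn (pseries (pseries_diffs c) r).
Proof.
move=> uc r1.
have cd := unit_radius_cvg_pseries (unit_radius_diffs uc) r1.
have := pseries_diffs_equiv cd; set s := (fun i => _) => cs.
apply: cvg_lim => //.
rewrite (_ : pseries _ r = r \*: series s); first exact: cvgZl_tmp.
apply/funext => n; rewrite /= /pseries /series /= scaler_sumr.
apply: eq_bigr => -[_|k _]; first by rewrite /s !mul0r scaler0.
by rewrite /s /= exprS /GRing.scale /=; ring.
Qed.

(* For the integer-valued variable equal to k with probability proportional to c_k r^k,
   [ps_mean c r] is the mean and [r * ps_mean_diff c r] the variance. *)
Definition ps_mean (R : realType) (c : nat -> R) (r : R) : R :=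
  limn (pseries (fun k => k%:R * c k) r) / limn (pseries c r).

Definition ps_mean_diff (R : realType) (c : nat -> R) (r : R) : R :=
  (limn (pseries (pseries_diffs (fun k => k%:R * c k)) r) * limn (pseries c r)
   - limn (pseries (fun k => k%:R * c k) r) * limn (pseries (pseries_diffs c) r))
  / limn (pseries c r) ^+ 2.

Lemma is_derive_ps_mean (R : realType) (c : nat -> R) (r : R) :
  (forall k, 0 <= c k) -> 1 <= c 0 -> unit_radius c -> 0 <= r < 1 ->
  is_derive r (1 : R) (ps_mean c) (ps_mean_diff c r).
Proof.
move=> c0 c01 uc r01; have /andP[r0 r1] := r01.
have nr1 : `|r| < 1 by rewrite ger0_norm.
have F0 : limn (pseries c r) != 0.
  by rewrite gt_eqF// (lt_le_trans ltr01)// pseries_sum_ge1.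
have d1 := is_derive_pseries uc nr1.
have d2 := is_derive_pseries (unit_radius_natmul uc) nr1.
have d3 := is_deriveV F0 d1.
have := is_deriveM d2 d3; congr is_derive.
by rewrite /ps_mean_diff /GRing.scale /= -exprVn; field.
Qed.

Lemma ps_mean_ge0 (R : realType) (c : nat -> R) (r : R) :
  (forall k, 0 <= c k) -> unit_radius c -> 0 <= r < 1 -> 0 <= ps_mean c r.
Proof.
move=> c0 uc r01; rewrite /ps_mean divr_ge0// pseries_sum_ge0//.
- by move=> k; rewrite mulr_ge0.
- exact: unit_radius_natmul.
Qed.

(** Expanding the square gives the series with coefficients [k ^ 2 * c k], [k * c k] and [c k]; two
    applications of the Euler operator identify their combination with [F * r A'], so [r A'] is the
    variance. *)
Lemma ps_variance_series (R : realType) (c : nat -> R) (r : R) :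
  (forall k, 0 <= c k) -> 1 <= c 0 -> unit_radius c -> 0 <= r < 1 ->
  series (fun k => (k%:R - ps_mean c r) ^+ 2 * (c k * r ^+ k)) @ \oo -->
    limn (pseries c r) * (r * ps_mean_diff c r).
Proof.
move=> c0 c01 uc r01; have /andP[r0 r1] := r01.
have nr1 : `|r| < 1 by rewrite ger0_norm.
have F0 : limn (pseries c r) != 0.
  by rewrite gt_eqF// (lt_le_trans ltr01)// pseries_sum_ge1.
pose e k := k%:R * c k.
have ue : unit_radius e := unit_radius_natmul uc.
have cc := unit_radius_cvg_pseries uc nr1.
have ce := unit_radius_cvg_pseries ue nr1.
have cee := unit_radius_cvg_pseries (unit_radius_natmul ue) nr1.
set A := ps_mean c r.
have -> : limn (pseries c r) * (r * ps_mean_diff c r) =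
  limn (pseries (fun k => k%:R * e k) r) +
  ((- (2 * A)) *: limn (pseries e r) + A ^+ 2 *: limn (pseries c r)).
  rewrite (pseries_natmul_sum ue nr1) (pseries_natmul_sum uc nr1).
  rewrite /ps_mean_diff /A /ps_mean -/e (pseries_natmul_sum uc nr1) /GRing.scale /=.
  by field.
rewrite (_ : series _ = fun n => pseries (fun k => k%:R * e k) r n +
  ((- (2 * A)) *: pseries e r n + A ^+ 2 *: pseries c r n)).
  by apply: cvgD => //; apply: cvgD; exact: cvgZl_tmp.
apply/funext => n; rewrite /= /pseries /series /= /GRing.scale /= !mulr_sumr.
by rewrite -!big_split /=; apply: eq_bigr => k _; rewrite /e; ring.
Qed.

Lemma ps_mean_diff_ge0 (R : realType) (c : nat -> R) (r : R) :
  (forall k, 0 <= c k) -> 1 <= c 0 -> unit_radius c -> 0 < r < 1 ->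
  0 <= ps_mean_diff c r.
Proof.
move=> c0 c01 uc /andP[r0 r1].
have r01 : 0 <= r < 1 by rewrite ltW.
have F0 : 0 < limn (pseries c r).
  by rewrite (lt_le_trans ltr01)// pseries_sum_ge1.
rewrite -(pmulr_rge0 _ r0) -(pmulr_rge0 _ F0).
have cv := ps_variance_series c0 c01 uc r01.
rewrite -(cvg_lim _ cv)//; apply: limr_ge; first exact: cvgP cv.
near=> n; apply: sumr_ge0 => k _; apply: mulr_ge0; first exact: sqr_ge0.
by rewrite mulr_ge0// exprn_ge0// ltW.
Unshelve. all: by end_near. Qed.

Lemma count_near_le (R : realType) (A s : R) n : 0 <= s ->
  \sum_(0 <= k < n) ((`|k%:R - A| <= s)%R)%:R <= 2 * s + 1 :> R.
Proof.
move=> s0.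
(* Stronger form for the induction: each counted [k] occupies the unit interval [[k, k + 1]], and
   these lie in [[A - s, A + s + 1]] cut at [n]. *)
suff H : \sum_(0 <= k < n) (`|k%:R - A| <= s :> R)%:R
    <= Num.max 0 (Num.min n%:R (A + s + 1) - (A - s)).
  apply: le_trans H _; rewrite ge_max; apply/andP; split; first by lra.
  have : Num.min n%:R (A + s + 1) <= A + s + 1 by rewrite ge_min lexx orbT.
  lra.
elim: n => [|n IH]; first by rewrite big_geq// le_max lexx.
rewrite big_nat_recr//=.
have n1 : n.+1%:R = n%:R + 1 :> R by rewrite -natr1.
case: (boolP (`|n%:R - A| <= s)) => [|_]; last first.
  rewrite addr0; apply: le_trans IH _; rewrite ge_max le_max lexx/=.
  rewrite le_max; apply/orP; right; rewrite lerB//.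
  by rewrite le_min !ge_min n1 lerDl ler01 lexx !orbT.
rewrite ler_norml => /andP[h1 h2].
have m1 : Num.min n%:R (A + s + 1) = n%:R by apply/min_idPl; lra.
have m2 : Num.min n.+1%:R (A + s + 1) = n%:R + 1 by rewrite n1; apply/min_idPl; lra.
rewrite m1 in IH; rewrite m2.
have M1 : Num.max 0 (n%:R - (A - s)) = n%:R - (A - s) by apply/max_idPr; lra.
rewrite M1 in IH.
rewrite le_max; apply/orP; right; rewrite (_ : true%:R = 1 :> R)//; lra.
Qed.

(* Chebyshev's inequality: at least half of the mass sits within sqrt (2 (V + 1))
   of the mean, where V is the variance. *)
Lemma pseries_sum_le_max_term (R : realType) (c : nat -> R) (r m : R) :
  (forall k, 0 <= c k) -> 1 <= c 0 -> unit_radius c -> 0 < r < 1 ->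
  (forall k, c k * r ^+ k <= m) ->
  limn (pseries c r) <=
    2 * m * (2 * Num.sqrt (2 * (r * ps_mean_diff c r + 1)) + 1).
Proof.
move=> c0 c01 uc r01 hm; have /andP[r0 r1] := r01.
have r01' : 0 <= r < 1 by rewrite ltW.
set V := r * ps_mean_diff c r; set A := ps_mean c r.
have V0 : 0 <= V by rewrite mulr_ge0// ?(ltW r0)// ps_mean_diff_ge0.
set F := limn _.
have F0 : 0 <= F by apply: pseries_sum_ge0.
(* With [s ^+ 2 = 2 * (V + 1)] the tail, at most [F * V / s ^+ 2], is at most [F / 2]; the added 1
   keeps [s] positive. *)
set s := Num.sqrt (2 * (V + 1)).
have s2 : s ^+ 2 = 2 * (V + 1) by rewrite sqr_sqrtr//; lra.
have s0 : 0 <= s by exact: sqrtr_ge0.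
have m0 : 0 <= m by apply: le_trans (hm 0); rewrite mulr_ge0.
pose q k := (k%:R - A) ^+ 2 * (c k * r ^+ k).
have q0 k : 0 <= q k.
  apply: mulr_ge0; first exact: sqr_ge0.
  by rewrite mulr_ge0// exprn_ge0// ltW.
have cv : series q @ \oo --> F * V by exact: ps_variance_series.
have part n : pseries c r n <= F / 2 + m * (2 * s + 1).
  have qn : series q n <= F * V.
    rewrite -(cvg_lim _ cv)//; apply: nondecreasing_cvgn_le; last first.
      exact: cvgP cv.
    exact: nondecreasing_series.
  (* A term within [s] of the mean is at most [m]; a farther one only grows when multiplied by
     [(k - A) ^+ 2 / s ^+ 2]. *)
  have : pseries c r n <=
    (s ^+ 2)^-1 * series q n + m * \sum_(0 <= k < n) (`|k%:R - A| <= s :> R)%:R.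
    rewrite /pseries /series /= !mulr_sumr -big_split /=.
    apply: ler_sum => k _.
    have t0 : 0 <= c k * r ^+ k by rewrite mulr_ge0// exprn_ge0// ltW.
    case: (boolP (`|k%:R - A| <= s)) => hk.
      rewrite mulr1; apply: le_trans (hm k) _.
      by rewrite lerDr mulr_ge0// invr_ge0 sqr_ge0.
    rewrite mulr0 addr0 /q mulrA ler_peMl//.
    rewrite mulrC ler_pdivlMr ?mul1r; last by rewrite s2; lra.
    rewrite -(real_normK (num_real (k%:R - A))) ler_sqr ?nnegrE//.
    by rewrite ltW// ltNge.
  move=> /le_trans; apply; apply: lerD.
    rewrite mulrC ler_pdivrMr; last by rewrite s2; lra.
    apply: le_trans qn _; rewrite s2.
    have -> : F / 2 * (2 * (V + 1)) = F * V + F by field.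
    by rewrite lerDl.
  by rewrite ler_wpM2l// count_near_le.
have : F <= F / 2 + m * (2 * s + 1).
  apply: limr_le; last by near=> n; exact: part.
  by apply: unit_radius_cvg_pseries => //; rewrite ger0_norm// ltW.
by move=> ?; lra.
Unshelve. all: by end_near. Qed.

(* [x `^ tau <= 1 + x] at [x = (1 + k) / (1 + A)]. *)
Lemma pseries_powR_moment (R : realType) (c : nat -> R) (r tau : R) n :
  (forall k, 0 <= c k) -> 1 <= c 0 -> unit_radius c -> 0 <= r < 1 ->
  0 <= tau <= 1 ->
  \sum_(0 <= k < n) k.+1%:R `^ tau * (c k * r ^+ k) <=
    2 * (1 + ps_mean c r) `^ tau * limn (pseries c r).
Proof.
move=> c0 c01 uc r01 /andP[t0 t1]; have /andP[r0 r1] := r01.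
have nr1 : `|r| < 1 by rewrite ger0_norm.
set A := ps_mean c r; set F := limn _.
have F1 : 1 <= F by exact: pseries_sum_ge1.
have A0 : 0 <= A by exact: ps_mean_ge0.
have A1 : 0 < 1 + A by lra.
have pw (x : R) : 0 <= x -> x `^ tau <= 1 + x.
  move=> x0; have [x1|x1] := leP x 1.
    apply: (@le_trans _ _ (1 `^ tau)); first by rewrite ge0_ler_powR// nnegrE.
    by rewrite powR1; lra.
  apply: (@le_trans _ _ (x `^ 1)); first by rewrite ler_powR// ltW.
  by rewrite powRr1//; lra.
have term k : k.+1%:R `^ tau <= (1 + A) `^ tau * (1 + (k%:R + 1) / (1 + A)).
  have -> : k.+1%:R = (1 + A) * ((k%:R + 1) / (1 + A)) :> R.
    by rewrite -natr1; field; rewrite gt_eqF.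
  rewrite powRM ?(ltW A1)//; last by rewrite divr_ge0// ltW.
  rewrite ler_wpM2l ?powR_ge0//.
  by apply: pw; rewrite divr_ge0 ?addr_ge0// ltW.
apply: (@le_trans _ _ ((1 + A) `^ tau *
    (pseries c r n + (1 + A)^-1 * (pseries (fun k => k%:R * c k) r n + pseries c r n)))).
  rewrite /pseries /series /= -big_split/= mulr_sumr -big_split/= mulr_sumr.
  apply: ler_sum => k _.
  apply: le_trans (ler_wpM2r _ (term k)) _; first by rewrite mulr_ge0// exprn_ge0.
  by rewrite le_eqVlt; apply/orP; left; apply/eqP; field; rewrite gt_eqF.
rewrite -mulrA mulrCA ler_wpM2l ?powR_ge0//.
have h1 : pseries c r n <= F by exact: pseries_partial_le.
have h2 : pseries (fun k => k%:R * c k) r n <= A * F.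
  rewrite /A /ps_mean -/F divfK ?gt_eqF//; last by lra.
  apply: pseries_partial_le => //; last exact: unit_radius_natmul.
  by move=> k; rewrite mulr_ge0.
have : (1 + A)^-1 * (pseries (fun k => k%:R * c k) r n + pseries c r n) <= F.
  rewrite mulrC ler_pdivrMr//; lra.
lra.
Qed.

(** * Exceptional sets for the growth of a derivative *)

(* [- (ln u)^-1] is nondecreasing with values in [-1, 0], so its derivative,
   which dominates [h] on the exceptional set, has integral at most 1. *)
Lemma wiman_exceptional (R : realType) (h u u' : R -> R) :
  {in `]0, 1[, forall r, 0 < h r} -> measurable_fun (`]0, 1[%classic : set R) h ->
  {in `]0, 1[, forall r, is_derive r (1 : R) u (u' r)} ->
  {in `]0, 1[, continuous u'} ->
  {in `]0, 1[, forall r, 0 <= u' r} ->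
  {in `]0, 1[, forall r, expR 1 <= u r} ->
  let E : set R := `]0, 1[%classic `&` [set r | h r * (u r * ln (u r) ^+ 2) < u' r] in
  measurable E /\ (\int[lebesgue_measure]_(r in E) (h r)%:E <= 1)%E.
Proof.
move=> h0 mh du cu' u'0 ue E.
have u0 (r : R) : r \in `]0, 1[ -> 0 < u r.
  by move=> /ue; apply: lt_le_trans; exact: expR_gt0.
have lnu (r : R) : r \in `]0, 1[ -> 1 <= ln (u r).
  by move=> r01; rewrite -(expRK 1) ler_ln ?posrE ?expR_gt0 ?u0 ?ue.
pose v r := - (ln (u r))^-1.
pose v' r := u' r / (u r * ln (u r) ^+ 2).
have cu : {in `]0, 1[, continuous u}.
  move=> r /du dr; apply/differentiable_continuous/derivable1_diffP.
  exact: ex_derive.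
have cln : {in `]0, 1[, continuous (fun r => ln (u r))}.
  by move=> r r01; apply: continuous_comp; [exact: cu|apply: continuous_ln; exact: u0].
have cw : {in `]0, 1[, continuous (fun r => u r * ln (u r) ^+ 2)}.
  move=> r r01; apply: cvgM; first exact: cu.
  by apply: cvgM; exact: cln.
have w0 (r : R) : r \in `]0, 1[ -> 0 < u r * ln (u r) ^+ 2.
  by move=> r01; rewrite mulr_gt0 ?u0// exprn_gt0// (lt_le_trans ltr01)// lnu.
have cv' : {in `]0, 1[, continuous v'}.
  move=> r r01; apply: cvgM; first exact: cu'.
  by apply: cvgV; [rewrite gt_eqF// w0|exact: cw].
have dv (r : R) : r \in `]0, 1[ -> is_derive r (1 : R) v (v' r).
  move=> r01; have d1 := du _ r01.
  have d2 : is_derive (u r) (1 : R) (@ln R) (u r)^-1 by apply: is_derive1_ln; exact: u0.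
  have l0 : ln (u r) != 0 by rewrite gt_eqF// (lt_le_trans ltr01)// lnu.
  have d3 : is_derive r (1 : R) (fun r => ln (u r)) ((u r)^-1 * u' r).
    exact: is_derive1_comp.
  have d4 := @is_deriveV _ (fun r => ln (u r)) _ _ _ l0 d3.
  have := is_deriveN d4; congr is_derive.
  rewrite /v' /GRing.scale /=; field.
  by rewrite l0 gt_eqF// u0.
have oI : open (`]0, 1[%classic : set R) by exact: interval_open.
have inI : forall P : R -> Prop,
    {in `]0, 1[, forall x, P x} -> {in `]0, 1[%classic, forall x, P x}.
  by move=> P HP x; rewrite inE/= => x01; exact: HP.
have mu' : measurable_fun (`]0, 1[%classic : set R) u'.
  by apply: open_continuous_measurable_fun => //; exact: inI.
have mw : measurable_fun (`]0, 1[%classic : set R) (fun r => u r * ln (u r) ^+ 2).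
  apply: open_continuous_measurable_fun => //.
  exact: (inI (fun r => {for r, continuous (fun r => u r * ln (u r) ^+ 2)})).
have mv' : measurable_fun (`]0, 1[%classic : set R) v'.
  by apply: open_continuous_measurable_fun => //; exact: inI.
have mE : measurable E.
  rewrite /E -preimage_true.
  by apply: (measurable_fun_ltr (measurable_funM mh mw) mu').
split => //.
have EI : E `<=` `]0, 1[ by move=> r [].
have v'0 (r : R) : r \in `]0, 1[ -> 0 <= v' r.
  by move=> r01; rewrite divr_ge0 ?u'0// ltW// w0.
apply: (@le_trans _ _ (\int[lebesgue_measure]_(r in E) (v' r)%:E)%E).
  apply: ge0_le_integral => //.
  - by move=> r [/h0 hr _]; rewrite lee_fin ltW.
  - by apply/measurable_EFinP; exact: measurable_funS mh.
  - by apply/measurable_EFinP; exact: measurable_funS mv'.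
  - move=> r [r01 /ltW hr]; rewrite lee_fin /v' ler_pdivlMr//; exact: w0.
apply: (@le_trans _ _ (\int[lebesgue_measure]_(r in `]0%R, 1%R[) (v' r)%:E)%E).
  apply: ge0_subset_integral => //; first exact/measurable_EFinP.
(* Exhaustion of the open interval by segments, where the fundamental theorem of calculus applies;
   starting at 1/3 keeps the two endpoints apart. *)
pose F n : set R := `[n.+3%:R^-1, 1 - n.+3%:R^-1]%classic.
have FI n : F n `<=` `]0, 1[.
  move=> x; rewrite /F/= !in_itv/= => /andP[x1 x2].
  have i0 : 0 < n.+3%:R^-1 :> R by rewrite invr_gt0.
  rewrite (lt_le_trans i0 x1)/=; apply: le_lt_trans x2 _.
  by rewrite ltrBlDr ltrDl.
have nF : nondecreasing_seq F.
  move=> m n mn; rewrite subsetEset => x; rewrite /F/= !in_itv/= => /andP[x1 x2].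
  have i0 : n.+3%:R^-1 <= m.+3%:R^-1 :> R by rewrite lef_pV2 ?posrE// ler_nat.
  rewrite (le_trans i0 x1)/=; apply: le_trans x2 _.
  by rewrite lerD2l lerN2.
have UF : \bigcup_n F n = `]0, 1[%classic.
  apply/seteqP; split => [x [n _ /FI]//|x /=]; rewrite in_itv/= => /andP[x0 x1].
  pose d := Num.min x (1 - x).
  have d0 : 0 < d by rewrite /d lt_min; apply/andP; split; lra.
  have dx : d <= x by rewrite /d ge_min lexx.
  have dx1 : d <= 1 - x by rewrite /d ge_min lexx orbT.
  have [n hn] : exists n : nat, d^-1 <= n.+3%:R.
    exists (Num.truncn d^-1); apply/ltW; apply: lt_le_trans (truncnS_gt _) _.
    by rewrite ler_nat (leqW (leqW (leqnn _))).
  have hd : n.+3%:R^-1 <= d by rewrite -[leLHS]div1r ler_pdivrMr// -ler_pdivrMl// mulr1.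
  exists n => //; rewrite /F/= in_itv/= (le_trans hd dx)/= lerBrDr.
  by rewrite -lerBrDl (le_trans hd).
rewrite -UF; apply: (cvge_to_le (ge0_nondecreasing_set_cvg_integral _ _ _ _)) => //.
- by move=> n; exact: measurable_itv.
- move=> n; apply/measurable_EFinP; apply: measurable_funS mv' => //.
- by move=> n x /FI x01; rewrite lee_fin v'0.
near=> n.
rewrite /F; set a : R := n.+3%:R^-1; set b := 1 - a.
have a0 : 0 < a by rewrite invr_gt0.
have a3 : a <= 3^-1 by rewrite /a lef_pV2 ?posrE// ler_nat.
have ab : a < b by rewrite /b; lra.
have abI (x : R) : a <= x <= b -> x \in `]0, 1[.
  move=> /andP[x1 x2]; rewrite in_itv/= (lt_le_trans a0 x1)/=.
  by apply: le_lt_trans x2 _; rewrite /b ltrBlDr ltrDl.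
have a01 : a \in `]0, 1[ by apply: abI; rewrite lexx ltW.
have b01 : b \in `]0, 1[ by apply: abI; rewrite lexx ltW.
have cv (x : R) : x \in `]0, 1[ -> {for x, continuous v}.
  move=> /dv dx; apply/differentiable_continuous/derivable1_diffP.
  exact: ex_derive.
rewrite (@continuous_FTC2 _ v' v)//.
- rewrite -EFinB lee_fin /v.
  have := lnu _ b01; have := lnu _ a01 => la lb.
  have : 0 < (ln (u b))^-1 by rewrite invr_gt0; lra.
  have : (ln (u a))^-1 <= 1 by rewrite invf_le1; lra.
  lra.
- apply: continuous_in_subspaceT => x; rewrite inE/= in_itv/= => hx.
  by apply: cv'; exact: abI.
- split.
  + move=> x; rewrite in_itv/= => /andP[/ltW x1 /ltW x2].
    by have d := dv _ (abI _ (introT andP (conj x1 x2))); exact: ex_derive.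
  + by apply: cvg_at_right_filter; exact: cv.
  + by apply: cvg_at_left_filter; exact: cv.
- move=> x; rewrite in_itv/= => /andP[/ltW x1 /ltW x2].
  have d := dv _ (abI _ (introT andP (conj x1 x2))).
  by rewrite derive1E; exact: derive_val.
Unshelve. all: by end_near. Qed.

(** * Riesz products and exponential moments of lacunary sums *)

Lemma continuous_integrable_itv (R : realType) (f : R -> R) (a b : R) :
  continuous f -> (@lebesgue_measure R).-integrable `[a, b] (EFin \o f).
Proof.
move=> cf; apply: continuous_compact_integrable; first exact: segment_compact.
exact: continuous_subspaceT.
Qed.

Lemma continuous_cos_affine (R : realType) (w b : R) :
  continuous (fun t : R => cos (w * t + b)).
Proof.
move=> t; apply: (@continuous_comp _ _ _ (fun t => w * t + b) (@cos R)).
  by apply: cvgD; [apply: cvgMl_tmp; exact: cvg_id|exact: cvg_cst].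
exact: continuous_cos.
Qed.

(** The number [N] of periods is left free because the windows of integration must later exhaust the
    line. *)
Lemma Rintegral_cos_period (R : realType) (a b beta : R) (w N : nat) :
  a < b -> b = a + (pi *+ 2) *+ N -> (0 < w)%N ->
  \int[lebesgue_measure]_(t in `[a, b]) cos (w%:R * t + beta) = 0.
Proof.
move=> ab bE w0.
have w0' : w%:R != 0 :> R by rewrite pnatr_eq0 -lt0n.
pose F (t : R) := w%:R^-1 * sin (w%:R * t + beta).
have dF (t : R) : is_derive t (1 : R) F (cos (w%:R * t + beta)).
  have d1 : is_derive t (1 : R) (fun t => w%:R * t + beta) w%:R.
    have := is_deriveD (is_deriveZ w%:R (is_derive_id t (1 : R)))
                       (is_derive_cst beta t (1 : R)).
    by congr is_derive; rewrite /GRing.scale /= addr0 mulr1.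
  have d2 := @is_derive1_comp _ (@sin R) (fun t => w%:R * t + beta) _ _ _
    (is_derive_sin (w%:R * t + beta)) d1.
  have := is_deriveZ w%:R^-1 d2; congr is_derive.
  by rewrite /GRing.scale /= mulrC mulrK// unitfE.
have cF : continuous F.
  move=> t; apply/differentiable_continuous/derivable1_diffP.
  by have d := dF t; exact: ex_derive.
rewrite /Rintegral (@continuous_FTC2 _ (fun t => cos (w%:R * t + beta)) F)//.
- rewrite /F bE.
  have -> : w%:R * (a + (pi *+ 2) *+ N) + beta =
      (w%:R * a + beta) + (pi *+ 2) *+ (w * N).
    by rewrite mulrDr addrAC [_ * (pi *+ _ *+ _)]mulr_natl -[in LHS]mulrnA mulnC.
  by rewrite (periodicn (@sinD2pi R)) subee.
- by apply: continuous_subspaceT; exact: continuous_cos_affine.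
- split => [t _||].
  + by have d := dF t; exact: ex_derive.
  + by apply: cvg_at_right_filter; exact: cF.
  + by apply: cvg_at_left_filter; exact: cF.
- by move=> t _; have d := dF t; rewrite derive1E; exact: derive_val.
Qed.

Definition riesz_product (R : realType) (theta : nat -> nat) (y beta : nat -> R)
  (n : nat) (t : R) : R :=
  \prod_(0 <= k < n) (1 + y k * cos ((theta k)%:R * t + beta k)).

Lemma riesz_productS (R : realType) (theta : nat -> nat) (y beta : nat -> R)
  (n : nat) (t : R) : riesz_product theta y beta n.+1 t =
  riesz_product theta y beta n t * (1 + y n * cos ((theta n)%:R * t + beta n)).
Proof. by rewrite /riesz_product big_nat_recr. Qed.

Lemma continuous_riesz_product (R : realType) (theta : nat -> nat)
  (y beta : nat -> R) n : continuous (riesz_product theta y beta n).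
Proof.
elim: n => [|n IH].
  rewrite (_ : riesz_product _ _ _ _ = cst 1); first exact: cst_continuous.
  by apply/funext => t; rewrite /riesz_product big_geq.
rewrite (_ : riesz_product _ _ _ _ = fun t => riesz_product theta y beta n t *
    (1 + y n * cos ((theta n)%:R * t + beta n))); last first.
  by apply/funext => t; rewrite riesz_productS.
move=> t; apply: cvgM; first exact: IH.
apply: cvgD; first exact: cvg_cst.
by apply: cvgMl_tmp; exact: continuous_cos_affine.
Qed.

Lemma continuous_mulr_cos (R : realType) (f : R -> R) (w b : R) :
  continuous f -> continuous (fun t => f t * cos (w * t + b)).
Proof.
by move=> cf t; apply: cvgM; [exact: cf|exact: continuous_cos_affine].
Qed.

(* The frequencies of the product are signed sums of the theta k with p k, so they
   cannot reach w. *)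
Lemma riesz_product_orth (R : realType) (a b : R) (N : nat) (theta : nat -> nat)
    (p : pred nat) (y beta : nat -> R) (n w : nat) (gam : R) :
  a < b -> b = a + (pi *+ 2) *+ N -> (forall k, ~~ p k -> y k = 0) ->
  (\sum_(0 <= k < n | p k) theta k < w)%N ->
  \int[lebesgue_measure]_(t in `[a, b])
    (riesz_product theta y beta n t * cos (w%:R * t + gam)) = 0.
Proof.
move=> ab bE y0; elim: n w gam => [|n IH] w gam hw.
  transitivity (\int[lebesgue_measure]_(t in `[a, b]) (cos (w%:R * t + gam))).
    by apply: eq_Rintegral => t _; rewrite /riesz_product big_geq// mul1r.
  by rewrite (Rintegral_cos_period _ ab bE)// (leq_ltn_trans _ hw).
move: hw; rewrite big_mkcond big_nat_recr//= -big_mkcond/= => hw.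
case: (boolP (p n)) hw => pn hw; last first.
  transitivity (\int[lebesgue_measure]_(t in `[a, b]) (riesz_product theta y beta n t *
      cos (w%:R * t + gam))).
    by apply: eq_Rintegral => t _; rewrite riesz_productS y0// mul0r addr0 mulr1.
  by apply: IH; rewrite addn0 in hw.
have wt : (theta n <= w)%N by lia.
pose P := riesz_product theta y beta n.
have cP : continuous P by exact: continuous_riesz_product.
pose g1 (t : R) := P t * cos (w%:R * t + gam).
pose g2 (t : R) := P t * cos ((w - theta n)%:R * t + (gam - beta n)).
pose g3 (t : R) := P t * cos ((w + theta n)%:R * t + (gam + beta n)).
have c1 : continuous g1 by exact: continuous_mulr_cos.
have c2 : continuous g2 by exact: continuous_mulr_cos.
have c3 : continuous g3 by exact: continuous_mulr_cos.
have cs (h : R -> R) (k : R) : continuous h -> continuous (fun t => k * h t).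
  by move=> ch t; apply: cvgMl_tmp; exact: ch.
have cd (h k : R -> R) : continuous h -> continuous k -> continuous (fun t => h t + k t).
  by move=> ch ck t; apply: cvgD; [exact: ch|exact: ck].
have ii (h : R -> R) : continuous h ->
  (@lebesgue_measure R).-integrable `[a, b] (EFin \o h).
  exact: continuous_integrable_itv.
(* Product-to-sum formula. The frequencies [w], [w - theta n] and [w + theta n] all exceed the sum
   of the earlier selected ones, so the induction hypothesis kills each integral. *)
transitivity (\int[lebesgue_measure]_(t in `[a, b]) (g1 t + (y n / 2) * (g2 t + g3 t))).
  apply: eq_Rintegral => t _; rewrite riesz_productS.
  rewrite -/(P t) /g1 /g2 /g3.
  rewrite natrB// natrD.
  set U := w%:R * t + gam; set W := (theta n)%:R * t + beta n.
  rewrite (_ : (w%:R - (theta n)%:R) * t + (gam - beta n) = U - W); last first.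
    by rewrite /U /W; ring.
  rewrite (_ : (w%:R + (theta n)%:R) * t + (gam + beta n) = U + W); last first.
    by rewrite /U /W; ring.
  clearbody U W; by rewrite cosB cosD; field.
rewrite RintegralD//; [|exact: ii|by apply: ii; apply: cs; exact: cd].
rewrite RintegralZl//; last by apply: ii; exact: cd.
rewrite RintegralD//; [|exact: ii|exact: ii].
have hw1 := leq_ltn_trans (leq_addr (theta n) _) hw.
have hw2 := leq_trans hw1 (leq_addr (theta n) w).
rewrite /g1 /g2 /g3 (IH w)// (IH (w - theta n)%N); last by rewrite ltn_subRL addnC.
by rewrite (IH (w + theta n)%N)// addr0 mulr0 addr0.
Qed.

(** Each new factor leaves the integral unchanged: its cosine has a frequency above the sum of all
    earlier ones, hence is orthogonal to the product so far. *)
Lemma Rintegral_riesz_product (R : realType) (a b : R) (N : nat)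
    (theta : nat -> nat) (p : pred nat) (y beta : nat -> R) (n : nat) :
  a < b -> b = a + (pi *+ 2) *+ N -> (forall k, ~~ p k -> y k = 0) ->
  (forall k, (k < n)%N -> p k -> (\sum_(0 <= i < k | p i) theta i < theta k)%N) ->
  \int[lebesgue_measure]_(t in `[a, b]) riesz_product theta y beta n t = b - a.
Proof.
move=> ab bE y0; elim: n => [|n IH] hp.
  transitivity (\int[lebesgue_measure]_(t in `[a, b]) ((1 : R))).
    by apply: eq_Rintegral => t _; rewrite /riesz_product big_geq.
  have lm : lebesgue_measure (`[a, b]%classic : set R) = (b - a)%:E.
    by rewrite lebesgue_measure_itv/= lte_fin ab EFinB.
  rewrite Rintegral_cst// mul1r; exact: (congr1 fine lm).
have {}IH := IH (fun k kn => hp k (ltnW kn)).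
pose P := riesz_product theta y beta n.
have cP : continuous P by exact: continuous_riesz_product.
pose g (t : R) := P t * cos ((theta n)%:R * t + beta n).
have cg : continuous g by exact: continuous_mulr_cos.
transitivity (\int[lebesgue_measure]_(t in `[a, b]) (P t + y n * g t)).
  apply: eq_Rintegral => t _; rewrite riesz_productS.
  by rewrite -/(P t) /g; ring.
rewrite RintegralD//; [|exact: continuous_integrable_itv|]; last first.
  apply: continuous_integrable_itv => t; apply: cvgMl_tmp; exact: cg.
rewrite RintegralZl//; last exact: continuous_integrable_itv.
rewrite /P IH; case: (boolP (p n)) => pn; last by rewrite y0// mul0r addr0.
by rewrite /g /P (riesz_product_orth _ _ ab bE y0) ?mulr0 ?addr0// hp.
Qed.

(** From [1 - u <= expR (- u)] and [(1 + u + 2 u^2) (1 - u) = 1 + u^2 (1 - 2 u) >= 1]. *)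
Lemma expR_le_quadratic (R : realType) (u : R) :
  u <= 2^-1 -> expR u <= 1 + u + 2 * u ^+ 2.
Proof.
move=> u2; have h := expR_ge1Dx (- u); rewrite expRN in h.
have u1 : 0 < 1 - u by lra.
have : expR u <= (1 - u)^-1.
  by rewrite -[leLHS]invrK lef_pV2 ?posrE ?invr_gt0 ?expR_gt0.
move=> /le_trans; apply; rewrite -[leLHS]mul1r ler_pdivrMr//.
have : 0 <= u ^+ 2 * (1 - 2 * u) by rewrite mulr_ge0 ?sqr_ge0//; lra.
by move=> ?; lra.
Qed.

(** Each factor satisfies [expR (x cos) <= 1 + 2 x^2 + x cos = (1 + 2 x^2) (1 + y cos)] with
    [y = x / (1 + 2 x^2)]. The factors [1 + 2 x^2] are absorbed in the exponential of the squares;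
    the others form a nonnegative Riesz product of integral [b - a]. *)
Lemma integral_expR_lacunary (R : realType) (a b : R) (N : nat)
    (theta : nat -> nat) (p : pred nat) (x beta : nat -> R) (n : nat) :
  a < b -> b = a + (pi *+ 2) *+ N -> (forall k, ~~ p k -> x k = 0) ->
  (forall k, (k < n)%N -> p k -> (\sum_(0 <= i < k | p i) theta i < theta k)%N) ->
  (forall k, `|x k| <= 2^-1) ->
  (\int[lebesgue_measure]_(t in `[a, b])
     (expR (\sum_(0 <= k < n) x k * cos ((theta k)%:R * t + beta k)))%:E <=
   ((b - a) * expR (2 * \sum_(0 <= k < n) x k ^+ 2))%:E)%E.
Proof.
move=> ab bE x0 hp xh.
pose y k := x k / (1 + 2 * x k ^+ 2).
have q0 k : 0 < 1 + 2 * x k ^+ 2 by rewrite ltr_wpDr// mulr_ge0// sqr_ge0.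
have y0 k : ~~ p k -> y k = 0 by move=> /x0 xk; rewrite /y xk mul0r.
pose C := expR (2 * \sum_(0 <= k < n) x k ^+ 2).
have pos k (t : R) : 0 <= 1 + y k * cos t.
  have : `|y k * cos t| <= 1.
    rewrite normrM -[leRHS]mulr1 ler_pM// ?cos_max//.
    rewrite /y normrM normfV [X in _ / X]gtr0_norm// ler_pdivrMr// mul1r.
    apply: le_trans (xh k) _; have := sqr_ge0 (x k); lra.
  by rewrite ler_norml => /andP[? _]; lra.
have le1 t : expR (\sum_(0 <= k < n) x k * cos ((theta k)%:R * t + beta k)) <=
    C * riesz_product theta y beta n t.
  rewrite expR_sum /C mulr_sumr expR_sum /riesz_product -big_split/=.
  apply: ler_prod => k _; rewrite expR_ge0/=.
  set cc := cos _.
  have c1 : `|cc| <= 1 by exact: cos_max.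
  have c2 : cc ^+ 2 <= 1.
    by rewrite -(real_normK (num_real cc)) expr_le1.
  apply: (@le_trans _ _ ((1 + 2 * x k ^+ 2) * (1 + y k * cc))); last first.
    by rewrite ler_wpM2r ?pos// expR_ge1Dx.
  have -> : (1 + 2 * x k ^+ 2) * (1 + y k * cc) = 1 + 2 * x k ^+ 2 + x k * cc.
    by rewrite /y; field; rewrite gt_eqF.
  apply: le_trans (expR_le_quadratic _) _.
    apply: le_trans (ler_norm _) _; rewrite normrM -[leRHS]mulr1.
    exact: ler_pM.
  have : x k ^+ 2 * cc ^+ 2 <= x k ^+ 2 by rewrite ler_piMr// sqr_ge0.
  rewrite exprMn; lra.
have cr := @continuous_riesz_product R theta y beta n.
have cCr : continuous (fun t => C * riesz_product theta y beta n t).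
  by move=> t; apply: cvgMl_tmp; exact: cr.
apply: (@le_trans _ _ (\int[lebesgue_measure]_(t in `[a, b])
   (C * riesz_product theta y beta n t)%:E)%E).
  apply: ge0_le_integral => //.
  - apply/measurable_EFinP; apply: measurableT_comp => //.
    apply: measurable_sum => k; apply: measurable_funM => //.
    apply: measurable_funTS; apply: continuous_measurable_fun.
    exact: continuous_cos_affine.
  - apply/measurable_EFinP; apply: measurable_funTS.
    exact: continuous_measurable_fun.
  - by move=> t _; rewrite lee_fin.
apply: (@le_trans _ _
   (\int[lebesgue_measure]_(t in `[a, b]) (C * riesz_product theta y beta n t)%R)%:E).
  rewrite /Rintegral fineK ?lexx//; apply: integrable_fin_num => //.
  exact: continuous_integrable_itv.
rewrite lee_fin RintegralZl//; last exact: continuous_integrable_itv.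
by rewrite (Rintegral_riesz_product _ ab bE y0 hp) mulrC.
Qed.

(** * Exceptional sets for almost every t *)

(* For almost every t the h-measure of the set where some G s r t exceeds h r is at
   most the integral over r of the sum of the G s r t, which is finite by Tonelli. *)
Lemma fubini_exceptional (R : realType) (h : R -> R) (G : nat -> R -> R -> R)
    (W : nat -> set R) (C : nat -> R) :
  {in `]0, 1[, forall r, 0 < h r} ->
  measurable_fun (`]0, 1[%classic : set R) h ->
  (forall s r t, 0 <= G s r t) ->
  (forall s, measurable_fun [set: R * R] (fun z => G s z.1 z.2)) ->
  (forall N, measurable (W N)) -> (forall t, exists N, W N t) ->
  (forall N, 0 <= C N) ->
  (forall N s r, (\int[lebesgue_measure]_(t in W N) (G s r t)%:E <=
     (C N / (2 ^ s.+1)%:R)%:E)%E) ->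
  {ae lebesgue_measure, forall t : R, exists E : set R,
    [/\ measurable E, E `<=` `]0, 1[,
      (\int[lebesgue_measure]_(r in E) (h r)%:E < +oo)%E &
      forall r, r \in `]0, 1[ -> ~ E r -> forall s, G s r t <= h r]}.
Proof.
move=> h0 mh G0 mG mW UW C0 GC.
pose I : set R := `]0, 1[%classic.
pose X (z : R * R) : \bar R := (\sum_(s <oo) (G s z.1 z.2)%:E)%E.
have mX : measurable_fun setT X.
  apply: (@ge0_emeasurable_sum _ _ _ _ (fun s z => (G s z.1 z.2)%:E) xpredT).
    by move=> s z _ _; rewrite lee_fin.
  by move=> s _; apply/measurable_EFinP.
have X0 z : (0 <= X z)%E by apply: nneseries_ge0 => s _ _; rewrite lee_fin.
have mI : measurable I by exact: measurable_itv.
pose f N := X \_ (I `*` W N).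
have mf N : measurable_fun setT (f N).
  apply/(measurable_restrictT _ _).1; first exact: measurableX.
  exact: measurable_funTS.
have f0 N z : (0 <= f N z)%E by apply: erestrict_ge0 => y _; exact: X0.
pose Psi N (t : R) := (\int[lebesgue_measure]_r f N (r, t))%E.
have mPsi N : measurable_fun setT (Psi N).
  exact: (@measurable_fun_fubini_tonelli_G _ _ _ _ _ lebesgue_measure _ (mf N) (f0 N)).
have Psi0 N t : (0 <= Psi N t)%E by apply: integral_ge0.
have PsiC N : (\int[lebesgue_measure]_t Psi N t <= (C N)%:E)%E.
  have -> : (\int[lebesgue_measure]_t Psi N t =
      \int[lebesgue_measure]_r \int[lebesgue_measure]_t f N (r, t))%E.
    have H := @fubini_tonelli _ _ _ _ _ lebesgue_measure lebesgue_measure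
      (f N) (mf N) (f0 N).
    exact: (esym H).
  apply: (@le_trans _ _ (\int[lebesgue_measure]_(r in I) (C N)%:E)%E).
    rewrite [leRHS]integral_mkcond; apply: ge0_le_integral => //.
    - by move=> r _; apply: integral_ge0.
    - exact: (@measurable_fun_fubini_tonelli_F _ _ _ _ _ lebesgue_measure _ (mf N) (f0 N)).
    - apply/(measurable_restrictT _ _).1 => //; exact: measurable_cst.
    - move=> r _; rewrite patchE; case: ifPn => rI; last first.
        rewrite integral0_eq// => t _; rewrite /f patchE ifF//.
        by apply/negP; rewrite inE => -[/= rI' _]; move: rI; rewrite notin_setE.
      apply: (@le_trans _ _ (\int[lebesgue_measure]_(t in W N) X (r, t))%E).
        rewrite [leRHS]integral_mkcond; apply: ge0_le_integral => //.
        + exact: (@measurable_fun_pair2 _ _ _ _ _ _ (f N) r (mf N)).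
        + apply: (measurable_restrictT _ (mW N)).1; apply: measurable_funTS.
          exact: (@measurable_fun_pair2 _ _ _ _ _ _ X r mX).
        + move=> t _; rewrite /f !patchE.
          case: ifPn => [|_]; last by case: ifP.
          by rewrite inE => -[_ /= tW]; rewrite ifT// inE.
      (* The weights [1 / 2 ^ s.+1] add up to one, so the integral over t is at most [C N] for every
         r, and the r-interval has length one. *)
      rewrite /X /= integral_nneseries//=.
      - apply: (@le_trans _ _ (\sum_(s <oo) (C N / (2 ^ s.+1)%:R)%:E)%E).
          apply: lee_nneseries => [s _ _|s _]; last exact: GC.
          by apply: integral_ge0 => t _; rewrite lee_fin.
        exact: epsilon_trick0.
      - exact: mW.
      - move=> s; apply/measurable_EFinP; apply: measurable_funTS.
        exact: (@measurable_fun_pair2 _ _ _ _ _ _ (fun z => G s z.1 z.2) r (mG s)).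
      - by move=> s t _; rewrite lee_fin.
  have lm : lebesgue_measure I = 1%:E :> \bar R.
    by rewrite /I lebesgue_measure_itv/= lte_fin ltr01 oppr0 adde0.
  rewrite integral_cst//; apply: (@le_trans _ _ ((C N)%:E * 1%:E)%E).
    by apply: lee_wpmul2l; [rewrite lee_fin|rewrite -lm].
  by rewrite mule1.
have fin : {ae lebesgue_measure, forall t : R, forall N, (Psi N t < +oo)%E}.
  apply: ae_foralln => N.
  have : lebesgue_measure.-integrable setT (Psi N).
    apply/integrableP; split; first exact: mPsi.
    apply: le_lt_trans (ltry (C N)); apply: le_trans (PsiC N).
    rewrite le_eqVlt; apply/orP; left; apply/eqP.
    by apply: eq_integral => t _; rewrite gee0_abs.
  move=> /(integrable_ae measurableT); apply: filterS => t /(_ Logic.I).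
  by rewrite ge0_fin_numE.
move: fin; apply: (@filterS _ _ (ae_filter_ringOfSetsType lebesgue_measure)) => t fint.
have [N tW] := UW t.
have PsiE : Psi N t = (\int[lebesgue_measure]_(r in I) X (r, t))%E.
  rewrite [RHS]integral_mkcond; apply: eq_integral => r _.
  rewrite /f !patchE; congr (if _ then _ else _).
  by apply/idP/idP; rewrite !inE; [case|move=> rI; split].
have mXt : measurable_fun setT (fun r => X (r, t)).
  exact: (@measurable_fun_pair1 _ _ _ _ _ _ X t mX).
pose E : set R := I `&` [set r | ((h r)%:E < X (r, t))%E].
have mE : measurable E.
  apply: measurable_lte => //; first exact/measurable_EFinP.
  exact: measurable_funTS.
exists E; split => //.
- by move=> r [].
- apply: le_lt_trans (fint N); rewrite PsiE.
  apply: (@le_trans _ _ (\int[lebesgue_measure]_(r in E) X (r, t))%E).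
    apply: ge0_le_integral => //.
    + by move=> r [/h0 /ltW hr _]; rewrite lee_fin.
    + by apply/measurable_EFinP; apply: measurable_funS mh => // r [].
    + exact: measurable_funTS.
    + by move=> r [_ /ltW].
  apply: ge0_subset_integral => //; first exact: measurable_funTS.
  by move=> r [].
- move=> r rI nE s; rewrite -lee_fin.
  have : (X (r, t) <= (h r)%:E)%E.
    by rewrite leNgt; apply/negP => hX; apply: nE; split.
  apply: le_trans.
  apply: le_trans (nneseries_lim_ge s.+1 _) => /=; last by move=> *; rewrite lee_fin.
  rewrite big_nat_recr//= leeDr//.
  by apply: sume_ge0 => k _; rewrite lee_fin.
Qed.

(** * Sums over residue classes and their uniform bounds *)

(** Strong induction: the members of the class before [k - K] contribute less than [theta (k - K)],
    so those before [k] contribute less than [2 * theta (k - K) <= theta k]. If [k - K] is not in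
    the class, nothing precedes [k]. *)
Lemma residue_class_dissociate (theta : nat -> nat) (K L U j : nat) :
  (0 < K)%N -> (forall n, (0 < theta n)%N) ->
  (forall n, (L <= n)%N -> (n + K < U)%N -> (2 * theta n <= theta (n + K))%N) ->
  let p n := [&& (L <= n)%N, (n < U)%N & (n %% K == j)%N] in
  forall k, p k -> (\sum_(0 <= i < k | p i) theta i < theta k)%N.
Proof.
move=> K0 t0 tK p; elim/ltn_ind => k IH pk; have /and3P[Lk kU kj] := pk.
have gap i : (i < k)%N -> p i -> (i <= k - K)%N /\ (K <= k)%N.
  move=> ik /and3P[_ _ ij].
  have : (i = k %[mod K])%N by rewrite (eqP ij) (eqP kj).
  move/eqP; rewrite eq_sym eqn_mod_dvd ?(ltnW ik)// => /dvdn_leq.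
  by rewrite subn_gt0 ik => /(_ isT) h; split; lia.
have [pkK|npkK] := boolP ((K <= k)%N && p (k - K)%N); last first.
  rewrite big_nat_cond big1 ?t0// => i /andP[/andP[_ ik] pi].
  have [ikK Kk] := gap i ik pi; exfalso; move: npkK; rewrite Kk/= /p.
  have /and3P[Li _ _] := pi.
  rewrite (leq_trans Li ikK) (leq_ltn_trans (leq_subr _ _) kU)/=.
  by rewrite -(modnDr (k - K)) subnK// kj.
have /andP[Kk {}pkK] := pkK; have /and3P[LkK _ _] := pkK.
have lt1 : (k - K < k)%N by lia.
rewrite (@big_cat_nat _ _ _ (k - K)%N)//=; last exact: ltnW.
rewrite [X in (_ + X)%N]big_ltn_cond//= pkK.
rewrite [X in (_ + (_ + X))%N]big_nat_cond [X in (_ + (_ + X))%N]big1; last first.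
  move=> i /andP[/andP[i1 ik] pi]; have [ikK _] := gap i ik pi.
  by move: i1; rewrite ltnNge ikK.
have := IH _ lt1 pkK; have := tK _ LkK; rewrite subnK// => /(_ kU).
lia.
Qed.

Lemma ler_dist_cos (R : realType) (x y : R) : `|cos x - cos y| <= `|x - y|.
Proof.
wlog xy : x y / x < y => [H|].
  have [xy|yx|->] := ltgtP x y; [exact: H| |by rewrite !subrr].
  by rewrite distrC [leRHS]distrC; exact: H.
have [c _ h] : exists2 c, c \in `]x, y[ & cos y - cos x = - sin c * (y - x).
  apply: (@MVT _ _ (fun c => - sin c)) => //.
  exact/continuous_subspaceT/continuous_cos.
by rewrite distrC h normrM normrN distrC ler_piMl// sin_max.
Qed.

Section lacunary_class.
Context {R : realType}.
Implicit Types (rho alpha : nat -> R) (p : pred nat) (r t psi b : R).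

Definition class_energy rho p U r : R :=
  \sum_(0 <= k < U) (if p k then (rho k * r ^+ k) ^+ 2 else 0).

(** Normalisation by [1 / (2 sqrt S)], S being the energy, so that the squares sum to at most 1/4.
    Written with [powR] it is measurable in r across [S = 0], where the terms of index below U
    vanish anyway. *)
Definition class_coef rho p U r (k : nat) : R :=
  if p k then rho k * r ^+ k * (class_energy rho p U r `^ (- 2^-1) / 2) else 0.

(** The real part of [e^(ib)] times the class part of the rotated series at [r e^(i psi)], for
    coefficients of modulus [rho k] and argument [alpha k]. *)
Definition class_sum (theta : nat -> nat) rho alpha p U r t psi b : R :=
  \sum_(0 <= k < U) (if p k then rho k * r ^+ k else 0) *
    cos ((theta k)%:R * t + (k%:R * psi + alpha k + b)).

Definition class_exp (theta : nat -> nat) rho alpha p U r t psi b : R :=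
  expR (\sum_(0 <= k < U) class_coef rho p U r k *
    cos ((theta k)%:R * t + (k%:R * psi + alpha k + b))).

Lemma class_energy_ge0 rho p U r : 0 <= class_energy rho p U r.
Proof. by apply: sumr_ge0 => k _; case: ifP => // _; exact: sqr_ge0. Qed.

Lemma class_term_le rho p U r k : (k < U)%N -> p k ->
  (rho k * r ^+ k) ^+ 2 <= class_energy rho p U r.
Proof.
move=> kU pk; rewrite /class_energy big_mkord.
rewrite (bigD1 (Ordinal kU))//= pk lerDl.
by apply: sumr_ge0 => i _; case: ifP => // _; exact: sqr_ge0.
Qed.

Lemma class_coefE rho p U r k : (k < U)%N -> 0 < class_energy rho p U r ->
  class_coef rho p U r k =
  (if p k then rho k * r ^+ k else 0) / (2 * Num.sqrt (class_energy rho p U r)).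
Proof.
move=> kU S0; rewrite /class_coef; case: ifP => _; last by rewrite mul0r.
by rewrite powRN powR12_sqrt ?(ltW S0)// invfM [2^-1 * _]mulrC.
Qed.

Lemma class_coef0 rho p U r k : (k < U)%N -> class_energy rho p U r = 0 ->
  class_coef rho p U r k = 0 /\ (if p k then rho k * r ^+ k else 0) = 0.
Proof.
move=> kU S0; rewrite /class_coef; case: ifP => // pk.
have := class_term_le rho r kU pk; rewrite S0 real_exprn_even_le0//= => /eqP ->.
by rewrite !mul0r.
Qed.

Lemma class_coef_sqr_sum rho p U r :
  \sum_(0 <= k < U) class_coef rho p U r k ^+ 2 <= 4^-1.
Proof.
have := class_energy_ge0 rho p U r; rewrite le_eqVlt => /predU1P[S0|S0].
  rewrite big_nat big1 ?invr_ge0// => k /andP[_ kU].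
  by have [-> _] := class_coef0 kU (esym S0); rewrite expr0n.
rewrite (_ : \sum_(0 <= k < U) _ =
    class_energy rho p U r / (2 * Num.sqrt (class_energy rho p U r)) ^+ 2).
  rewrite exprMn sqr_sqrtr ?(ltW S0)// ler_pdivrMr ?mulr_gt0//; lra.
set q := (2 * Num.sqrt _) ^+ 2; rewrite /class_energy mulr_suml !big_mkord.
apply: eq_bigr => k _; rewrite class_coefE ?ltn_ord// expr_div_n -/q.
by case: ifP => // _; rewrite expr0n.
Qed.

Lemma class_coef_le rho p U r k : (k < U)%N -> `|class_coef rho p U r k| <= 2^-1.
Proof.
move=> kU; rewrite -(@ler_sqr R) ?nnegrE ?invr_ge0// real_normK ?num_real//.
apply: (@le_trans _ _ 4^-1); last by lra.
apply: le_trans (class_coef_sqr_sum rho p U r).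
rewrite big_mkord (bigD1 (Ordinal kU))//= lerDl.
by apply: sumr_ge0 => i _; exact: sqr_ge0.
Qed.

Lemma class_sum_expE theta rho alpha p U r t psi b :
  0 < class_energy rho p U r ->
  class_exp theta rho alpha p U r t psi b =
  expR (class_sum theta rho alpha p U r t psi b /
        (2 * Num.sqrt (class_energy rho p U r))).
Proof.
move=> S0; rewrite /class_exp /class_sum mulr_suml !big_mkord.
by congr expR; apply: eq_bigr => k _; rewrite class_coefE ?ltn_ord// mulrAC.
Qed.

(* [class_sum] changes by at most [sqrt energy] between neighbours of the grid, because
   its derivative in psi is a sum of U terms, each at most [U * sqrt energy]. *)
Lemma class_sum_le_grid theta rho alpha p U D r t b (M : R) :
  (forall k, 0 <= rho k) -> 0 <= r -> (U ^ 2 <= D)%N -> (0 < D)%N -> 1 <= M ->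
  (forall l, (l < 8 * D)%N ->
     class_exp theta rho alpha p U r t (l%:R / D%:R) b <= M) ->
  forall psi, 0 <= psi < 8 ->
    class_sum theta rho alpha p U r t psi b <=
    Num.sqrt (class_energy rho p U r) * (2 * ln M + 1).
Proof.
move=> rho0 r0 UD D0 M1 hM psi /andP[psi0 psi8].
have D0' : 0 < D%:R :> R by rewrite ltr0n.
have := class_energy_ge0 rho p U r; rewrite le_eqVlt => /predU1P[S0|S0].
  rewrite /class_sum -S0 sqrtr0 mul0r big_nat big1 ?lexx// => k /andP[_ kU].
  by have [_ ->] := class_coef0 kU (esym S0); rewrite mul0r.
set Q := Num.sqrt _; have Q0 : 0 < Q by rewrite sqrtr_gt0.
(* Nearest grid point to the left, for the grid of step [1 / D] on [[0, 8)]. *)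
pose l := Num.truncn (psi * D%:R).
have /andP[l1 l2] : l%:R <= psi * D%:R < l.+1%:R.
  by apply: truncn_itv; rewrite mulr_ge0.
have lD : (l < 8 * D)%N.
  rewrite -(ltr_nat R); apply: le_lt_trans l1 _.
  by rewrite natrM ltr_pM2r.
have dpsi : `|psi - l%:R / D%:R| <= D%:R^-1.
  have -> : psi - l%:R / D%:R = (psi * D%:R - l%:R) / D%:R.
    by field; rewrite gt_eqF.
  rewrite normrM [X in _ * X]ger0_norm ?invr_ge0 ?(ltW D0')//.
  rewrite ler_piMl ?invr_ge0 ?(ltW D0')// ger0_norm ?subr_ge0//.
  by rewrite lerBlDl natr1 ltW.
have h1 : class_sum theta rho alpha p U r t (l%:R / D%:R) b <= 2 * Q * ln M.
  have := hM l lD; rewrite class_sum_expE// -/Q.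
  rewrite -ler_ln ?posrE ?expR_gt0// ?(lt_le_trans ltr01)// expRK.
  by rewrite ler_pdivrMr ?mulr_gt0// [leRHS]mulrC.
have h2 : class_sum theta rho alpha p U r t psi b -
    class_sum theta rho alpha p U r t (l%:R / D%:R) b <= Q.
  rewrite /class_sum -sumrB.
  (* Each of the U terms moves by at most [Q * U / D], and [U ^ 2 <= D]. *)
  apply: (@le_trans _ _ (\sum_(0 <= k < U) Q * (U%:R * D%:R^-1))).
    apply: ler_sum_nat => k /andP[_ kU].
    have ck : 0 <= (if p k then rho k * r ^+ k else 0) <= Q.
      case: ifP => pk; last by rewrite lexx ltW.
      have c0 : 0 <= rho k * r ^+ k by rewrite mulr_ge0// exprn_ge0.
      rewrite c0/= -(ger0_norm c0) -sqrtr_sqr ler_wsqrtr//.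
      exact: class_term_le.
    rewrite -mulrBr; apply: le_trans (ler_norm _) _; rewrite normrM.
    case/andP: ck => c0 cQ; rewrite (ger0_norm c0).
    apply: ler_pM => //; apply: le_trans (ler_dist_cos _ _) _.
    rewrite (_ : _ - _ = k%:R * (psi - l%:R / D%:R)); last by ring.
    rewrite normrM normr_nat; apply: ler_pM => //.
    by rewrite ler_nat ltnW.
  rewrite sumr_const_nat subn0 -[leLHS]mulr_natl mulrCA ler_piMr ?(ltW Q0)//.
  rewrite mulrA ler_pdivrMr// mul1r -natrM ler_nat.
  by move: UD; rewrite expnS expn1.
have -> : Q * (2 * ln M + 1) = 2 * Q * ln M + Q by ring.
lra.
Qed.

End lacunary_class.

Lemma integral_class_exp (R : realType) (a b : R) (N : nat) (theta : nat -> nat)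
    (rho alpha : nat -> R) (p : pred nat) (U : nat) (r psi c : R) :
  a < b -> b = a + (pi *+ 2) *+ N -> (forall k, p k -> (k < U)%N) ->
  (forall k, p k -> (\sum_(0 <= i < k | p i) theta i < theta k)%N) ->
  (\int[lebesgue_measure]_(t in `[a, b])
     (class_exp theta rho alpha p U r t psi c)%:E <= ((b - a) * expR 1)%:E)%E.
Proof.
move=> ab bE pU pd.
have x0 k : ~~ p k -> class_coef rho p U r k = 0.
  by rewrite /class_coef => /negbTE ->.
have xh k : `|class_coef rho p U r k| <= 2^-1.
  have [pk|/x0 ->] := boolP (p k); first exact/class_coef_le/pU.
  by rewrite normr0 invr_ge0.
apply: le_trans (integral_expR_lacunary _ ab bE x0 (fun k _ => pd k) xh) _.
rewrite lee_fin ler_wpM2l ?subr_ge0 ?(ltW ab)// ler_expR.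
have := class_coef_sqr_sum rho p U r; lra.
Qed.

Lemma measurable_class_exp (R : realType) (theta : nat -> nat)
    (rho alpha : nat -> R) (p : pred nat) (U : nat) (psi b : R) :
  measurable_fun [set: R * R]
    (fun z => class_exp theta rho alpha p U z.1 z.2 psi b).
Proof.
have m1 k : measurable_fun setT (fun r : R => class_coef rho p U r k).
  rewrite /class_coef; case: (p k) => //.
  apply: measurable_funM; first by apply: measurable_funM => //; exact: measurable_funX.
  apply: measurable_funM => //; apply: (measurableT_comp (measurable_powR _)).
  apply: measurable_sum => i; case: (p i) => //.
  by apply: measurable_funX; apply: measurable_funM => //; exact: measurable_funX.
have m2 k : measurable_fun setT
    (fun t : R => cos ((theta k)%:R * t + (k%:R * psi + alpha k + b))).
  by apply: continuous_measurable_fun; exact: continuous_cos_affine.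
apply: measurableT_comp => //; apply: measurable_sum => k.
apply: measurable_funM; first exact: (measurableT_comp (m1 k) measurable_fst).
exact: (measurableT_comp (m2 k) measurable_snd).
Qed.

Definition residue_block (L K : nat -> nat) (s j : nat) : pred nat :=
  fun n => [&& (L s <= n)%N, (n < L s.+1)%N & (n %% K s == j)%N].

(** The square meets the hypothesis of [class_sum_le_grid]; the successor keeps the size
    positive. *)
Definition grid_size (L : nat -> nat) (s : nat) : nat := ((L s.+1 ^ 2).+1)%N.

(** The number of triples (class, grid point, phase) in block [s], times the factor [2 ^ s.+1] that
    makes the sum over blocks converge. *)
Definition grid_weight (L K : nat -> nat) (s : nat) : nat :=
  (2 ^ s.+1 * (K s * (8 * grid_size L s) * 4))%N.

(* A union bound over all blocks, classes, grid points and the four phases. *)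
Lemma levy_exceptional (R : realType) (h : R -> R) (theta : nat -> nat)
    (rho alpha : nat -> R) (L K : nat -> nat) :
  {in `]0, 1[, forall r, 0 < h r} ->
  measurable_fun (`]0, 1[%classic : set R) h ->
  (forall n, (0 < theta n)%N) -> (forall k, 0 <= rho k) ->
  (forall s, (0 < K s)%N) ->
  (forall s n, (L s <= n)%N -> (n + K s < L s.+1)%N ->
     (2 * theta n <= theta (n + K s))%N) ->
  {ae lebesgue_measure, forall t : R, exists E : set R,
    [/\ measurable E, E `<=` `]0, 1[,
      (\int[lebesgue_measure]_(r in E) (h r)%:E < +oo)%E &
      forall r, r \in `]0, 1[ -> ~ E r ->
      forall s j d psi, (j < K s)%N -> (d < 4)%N -> 0 <= psi < 8 ->
      class_sum theta rho alpha (residue_block L K s j) (L s.+1) r t psi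
        (d%:R * (pi / 2)) <=
      Num.sqrt (class_energy rho (residue_block L K s j) (L s.+1) r) *
        (2 * ln (1 + (grid_weight L K s)%:R * h r) + 1)]}.
Proof.
move=> h0 mh t0 rho0 K0 tK.
pose D := grid_size L.
pose T s := ('I_(K s) * 'I_(8 * D s) * 'I_4)%type.
pose Y s (i : T s) r t := class_exp theta rho alpha (residue_block L K s i.1.1)
  (L s.+1) r t (i.1.2%:R / (D s)%:R) (i.2%:R * (pi / 2)).
(* Divided by its weight, [G s] has integral at most [C N / 2 ^ s.+1] over the window [W N];
   conversely [G s <= h] bounds every single exponential by the weight times [h]. *)
pose G s r t : R := (grid_weight L K s)%:R^-1 * \sum_(i : T s) Y s i r t.
have w0 s : 0 < (grid_weight L K s)%:R :> R.
  by rewrite ltr0n /grid_weight /grid_size !muln_gt0 expn_gt0 K0.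
have cT s : #|{: T s}| = (K s * (8 * D s) * 4)%N by rewrite !card_prod !card_ord.
have Y0 s i r t : 0 <= Y s i r t by exact: expR_ge0.
have mY s i : measurable_fun [set: R * R] (fun z => Y s i z.1 z.2).
  exact: measurable_class_exp.
pose B N : R := (pi *+ 2) *+ N.+1.
pose W N : set R := `[- B N, B N]%classic.
have pi2 : 0 < pi *+ 2 :> R by rewrite mulrn_wgt0// pi_gt0.
have B0 N : 0 < B N by rewrite mulrn_wgt0.
have BE N : B N = - B N + (pi *+ 2) *+ (N.+1 + N.+1).
  by rewrite mulrnDr /B addKr.
pose C N := (B N - (- B N)) * expR 1.
have G0 s r t : 0 <= G s r t.
  by rewrite /G mulr_ge0 ?invr_ge0 ?(ltW (w0 s))//; apply: sumr_ge0.
have mG s : measurable_fun [set: R * R] (fun z => G s z.1 z.2).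
  by apply: measurable_funM => //; exact: measurable_sum.
have mW N : measurable (W N) by exact: measurable_itv.
have UW t : exists N, W N t.
  have [N hN] : exists N, `|t| <= B N.
    exists (Num.truncn (`|t| / (pi *+ 2))).
    rewrite /B -mulr_natl -ler_pdivrMr//; apply/ltW; exact: truncnS_gt.
  by exists N; rewrite /W/= in_itv/= -ler_norml.
have C0 N : 0 <= C N.
  rewrite /C mulr_ge0 ?expR_ge0//; have := B0 N; lra.
have GC N s r : (\int[lebesgue_measure]_(t in W N) (G s r t)%:E <=
     (C N / (2 ^ s.+1)%:R)%:E)%E.
  have mYr (i : T s) : measurable_fun setT (Y s i r).
    exact: (@measurable_fun_pair2 _ _ _ _ _ _ (fun z => Y s i z.1 z.2) r (mY s i)).
  rewrite /G; under eq_integral do rewrite EFinM -sumEFin.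
  rewrite ge0_integralZl//; last 3 first.
  - exact: mW.
  - under eq_fun do rewrite sumEFin; apply/measurable_EFinP.
    by apply: measurable_sum => i; apply: measurable_funTS; exact: mYr.
  - by move=> t _; apply: sume_ge0 => i _; rewrite lee_fin.
  rewrite ge0_integral_sum//; last 3 first.
  - exact: mW.
  - by move=> i; apply/measurable_EFinP; apply: measurable_funTS; exact: mYr.
  - by move=> i t _; rewrite lee_fin.
  apply: (@le_trans _ _ ((grid_weight L K s)%:R^-1%:E * \sum_(i : T s) (C N)%:E)%E).
    apply: lee_wpmul2l; first by rewrite lee_fin invr_ge0 ltW.
    apply: lee_sum => i _.
    have NB : - B N < B N by have := B0 N; lra.
    apply: (integral_class_exp _ _ _ _ _ NB (BE N)).
      by move=> k /and3P[].
    exact: (@residue_class_dissociate theta (K s) (L s) (L s.+1) i.1.1 (K0 s) t0 (tK s)).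
  rewrite sumEFin -EFinM lee_fin sumr_const cT.
  rewrite -[C N *+ _]mulr_natr /grid_weight -/(D s) natrM.
  have aux (P Q c : R) : P != 0 -> Q != 0 -> (P * Q)^-1 * (c * Q) = c / P.
    by move=> ? ?; field; apply/andP.
  by rewrite aux ?lexx// pnatr_eq0 -lt0n ?expn_gt0// !muln_gt0 K0.
have := fubini_exceptional h0 mh G0 mG mW UW C0 GC.
apply: (@filterS _ _ (ae_filter_ringOfSetsType lebesgue_measure)) => t.
move=> [E [mE EI hE EG]]; exists E; split; [exact: mE|exact: EI|exact: hE|].
move=> r rI nE s j d psi jK d4 psi8.
apply: (@class_sum_le_grid _ _ _ _ _ _ (D s)) => //.
- by move: rI; rewrite in_itv/= => /andP[/ltW].
- by rewrite lerDl mulr_ge0 ?(ltW (w0 s))// ltW// h0.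
- move=> l lD; have := EG r rI nE s; rewrite /G mulrC ler_pdivrMr// mulrC => hG.
  pose i : T s := (Ordinal jK, Ordinal lD, Ordinal d4).
  apply: (@le_trans _ _ ((grid_weight L K s)%:R * h r)); last by rewrite lerDr.
  apply: le_trans hG; rewrite (bigD1 i)//= -[leLHS]/(Y s i r t) lerDl.
  by apply: sumr_ge0.
Qed.

(** * Summation over classes and dyadic blocks *)

Lemma residue_block_sum (R : realType) (L K : nat -> nat) (s : nat) (g : nat -> R) :
  (0 < K s)%N -> (L s <= L s.+1)%N ->
  \sum_(j < K s) \sum_(0 <= n < L s.+1)
    (if residue_block L K s j n then g n else 0) =
  \sum_(L s <= n < L s.+1) g n.
Proof.
move=> K0 LL; rewrite exchange_big/=.
transitivity (\sum_(0 <= n < L s.+1) (if (L s <= n)%N then g n else 0)).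
  apply: eq_big_nat => n /andP[_ nL].
  rewrite (bigD1 (Ordinal (ltn_pmod n K0)))//= /residue_block nL eqxx.
  rewrite big1 ?addr0 ?andbT// => j jn; rewrite ifF//.
  apply/negP => /and3P[_ _ /eqP nj]; move/negP: jn; apply.
  by apply/eqP/val_inj; rewrite /= nj.
rewrite (@big_cat_nat _ _ _ (L s))//= big_nat big1 ?add0r.
  by apply: eq_big_nat => n /andP[-> _].
by move=> n /andP[_ nL]; rewrite leqNgt nL.
Qed.

(** Cauchy-Schwarz: square the sum and bound each product of roots by the arithmetic mean. *)
Lemma sum_sqrt_le (R : realType) (K : nat) (x : 'I_K -> R) :
  (forall j, 0 <= x j) ->
  \sum_(j < K) Num.sqrt (x j) <= Num.sqrt (K%:R * \sum_(j < K) x j).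
Proof.
move=> x0.
have s0 : 0 <= \sum_(j < K) Num.sqrt (x j) by apply: sumr_ge0 => j _; exact: sqrtr_ge0.
rewrite -(ger0_norm s0) -sqrtr_sqr ler_wsqrtr// expr2 mulr_suml.
apply: (@le_trans _ _ (\sum_(i < K) \sum_(j < K) (x i / 2 + x j / 2))).
  apply: ler_sum => i _; rewrite mulr_sumr; apply: ler_sum => j _.
  have := sqr_ge0 (Num.sqrt (x i) - Num.sqrt (x j)).
  by rewrite sqrrB !sqr_sqrtr//; lra.
under eq_bigr do rewrite big_split/= sumr_const card_ord.
rewrite big_split/= sumr_const card_ord sumrMnl -mulr_suml -mulrnDl -splitr.
by rewrite mulr_natl.
Qed.

(** One factor [q ^+ s] absorbs [s.+1] at the cost of [(1 - q)^-1]; the other is summed as a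
    geometric series. *)
Lemma sum_natmul_geometric_le (R : realType) (q : R) S : 0 <= q < 1 ->
  \sum_(0 <= s < S) s.+1%:R * (q * q) ^+ s <= (1 - q)^-1 ^+ 2.
Proof.
move=> q01; have /andP[q0 q1] := q01; have q1' : 0 < 1 - q by rewrite subr_gt0.
apply: (@le_trans _ _ (\sum_(0 <= s < S) (1 - q)^-1 * q ^+ s)).
  apply: ler_sum => s _; rewrite exprMn mulrA ler_wpM2r ?exprn_ge0//.
  exact: natmul_expr_le.
rewrite -mulr_sumr expr2 ler_wpM2l ?invr_ge0 ?(ltW q1')//.
rewrite -[leRHS]mul1r ler_pdivlMr// big_mkord.
have := subrX1 q S; have : 0 <= q ^+ S by exact: exprn_ge0.
by move=> ? ?; lra.
Qed.

(** The shift by one makes the blocks start at index 0: in block [s], [n.+1] runs over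
    [[2 ^ s, 2 ^ s.+1)]. *)
Definition dyadic (s : nat) : nat := (2 ^ s).-1.

Lemma dyadicK s : (dyadic s).+1 = (2 ^ s)%N.
Proof. by rewrite /dyadic prednK// expn_gt0. Qed.

Lemma leq_dyadic s : (dyadic s <= dyadic s.+1)%N.
Proof. by rewrite -ltnS !dyadicK leq_exp2l. Qed.

Lemma powR_expn2 (R : realType) (tau : R) s :
  (2 ^ s)%:R `^ tau = (2 `^ tau) ^+ s.
Proof.
rewrite natrX -(powR_mulrn s (ler0n R 2)) -(powR_mulrn s (powR_ge0 2 tau)).
exact: powRAC.
Qed.

(* In the dyadic block s the energy is at most [2 `^ (- tau s)] times
   [mu * sum_n (n + 1) `^ tau c_n r^n], while the number of classes is at most
   [CK * 2 `^ (kappa s)]; Cauchy-Schwarz over the classes makes the sum over s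
   geometric. *)
Lemma lacunary_sum_bound (R : realType) (theta : nat -> nat)
    (rho alpha c : nat -> R) (K : nat -> nat) (r t psi b m a CK kappa tau : R) :
  (forall k, 0 <= rho k) -> (forall k, rho k <= c k) -> 1 <= c 0 ->
  unit_radius c -> 0 < r < 1 -> (forall k, rho k * r ^+ k <= m) ->
  (forall s, (0 < K s)%N) -> 0 <= tau <= 1 -> kappa < tau -> 0 <= a -> 0 <= CK ->
  (forall s, (K s)%:R <= CK * (2 `^ kappa) ^+ s) ->
  (forall s j, (j < K s)%N ->
    class_sum theta rho alpha (residue_block dyadic K s j) (dyadic s.+1) r t psi b <=
    Num.sqrt (class_energy rho (residue_block dyadic K s j) (dyadic s.+1) r) *
      (a * s.+1%:R)) ->
  forall S, \sum_(0 <= n < dyadic S)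
      rho n * r ^+ n * cos ((theta n)%:R * t + (n%:R * psi + alpha n + b)) <=
    a * Num.sqrt CK * (1 - 2 `^ ((kappa - tau) / 4))^-1 ^+ 2 *
    Num.sqrt (2 * m * (1 + ps_mean c r) `^ tau * limn (pseries c r)).
Proof.
move=> rho0 rhoc c01 uc r01 hm K0 tau01 kt a0 CK0 hK hS S.
have /andP[r0 r1] := r01; have r01' : 0 <= r < 1 by rewrite ltW.
have c0 k : 0 <= c k := le_trans (rho0 k) (rhoc k).
have m0 : 0 <= m by apply: le_trans (hm 0); rewrite mulr_ge0.
(* [q ^+ 4] is the ratio [2 ^ (kappa - tau)] of class count against energy decay. The square root
   taken over the classes leaves [(q * q) ^+ s], one half of which pays for the factor [s.+1]. *)
set q := 2 `^ ((kappa - tau) / 4).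
have q01 : 0 <= q < 1.
  rewrite powR_ge0/= /q /powR gt_eqF// expR_lt1 pmulr_llt0 ?ln_gt0 ?ltr1n//; lra.
set Q := 2 * m * _ * _.
pose V s := \sum_(dyadic s <= n < dyadic s.+1) (rho n * r ^+ n) ^+ 2.
have t0 n : 0 <= rho n * r ^+ n by rewrite mulr_ge0// exprn_ge0// ltW.
have V0 s : 0 <= V s by apply: sumr_ge0 => n _; exact: sqr_ge0.
have VQ s : V s * (2 `^ tau) ^+ s <= Q.
  apply: (@le_trans _ _ (m * \sum_(0 <= n < dyadic s.+1)
      n.+1%:R `^ tau * (c n * r ^+ n))); last first.
    have -> : Q = m * (2 * (1 + ps_mean c r) `^ tau * limn (pseries c r)).
      by rewrite /Q; ring.
    by apply: ler_wpM2l => //; exact: pseries_powR_moment.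
  rewrite -powR_expn2 /V mulr_suml mulr_sumr.
  rewrite [leRHS](@big_cat_nat _ _ _ (dyadic s)) ?leq_dyadic//=.
  apply: ler_wpDl.
    by apply: sumr_ge0 => n _; rewrite !mulr_ge0 ?powR_ge0 ?exprn_ge0// ltW.
  (* One factor of the square is bounded by [m], the other by [c n * r ^+ n], and [2 ^ s <= n.+1] in
     this block. *)
  apply: ler_sum_nat => n /andP[sn _]; rewrite expr2 -mulrA.
  apply: ler_pM => //; first by rewrite mulr_ge0 ?powR_ge0.
  rewrite mulrC; apply: ler_pM; rewrite ?powR_ge0//; last first.
    by rewrite ler_wpM2r// exprn_ge0// ltW.
  rewrite ge0_ler_powR ?nnegrE//; first by case/andP: tau01.
  by rewrite -dyadicK ler_nat.
have block s : \sum_(dyadic s <= n < dyadic s.+1)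
      rho n * r ^+ n * cos ((theta n)%:R * t + (n%:R * psi + alpha n + b)) <=
    a * Num.sqrt CK * Num.sqrt Q * (s.+1%:R * (q * q) ^+ s).
  rewrite -(residue_block_sum _ (K0 s) (leq_dyadic s)).
  apply: (@le_trans _ _ (\sum_(j < K s) Num.sqrt (class_energy rho
      (residue_block dyadic K s j) (dyadic s.+1) r) * (a * s.+1%:R))).
    apply: ler_sum => j _; apply: le_trans (hS s j (ltn_ord j)).
    rewrite le_eqVlt; apply/orP; left; apply/eqP; apply: eq_bigr => n _.
    by case: ifP => //; rewrite mul0r.
  rewrite -mulr_suml.
  have as0 : 0 <= a * s.+1%:R by rewrite mulr_ge0.
  apply: (@le_trans _ _ (Num.sqrt ((K s)%:R * V s) * (a * s.+1%:R))).
    apply: ler_wpM2r => //.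
    apply: le_trans (sum_sqrt_le _) _; first by move=> j; exact: class_energy_ge0.
    apply: ler_wsqrtr; apply: ler_wpM2l => //.
    by rewrite /V -(residue_block_sum _ (K0 s) (leq_dyadic s)).
  have KV : (K s)%:R * V s <= CK * Q * ((q * q) ^+ s) ^+ 2.
    have q4 : (q * q) ^+ s ^+ 2 = (2 `^ kappa) ^+ s / (2 `^ tau) ^+ s.
      have n2 : (2 : R) != 0 by rewrite pnatr_eq0.
      rewrite -exprM mulnC exprM -expr_div_n -powRN -powRD ?n2 ?implybT//.
      by congr (_ ^+ s); rewrite expr2 /q -!powRD ?n2 ?implybT//; congr (_ `^ _); field.
    have t2 : 0 < (2 `^ tau) ^+ s :> R by rewrite exprn_gt0// powR_gt0.
    rewrite q4 -[leLHS](mulfK (lt0r_neq0 t2)) mulrA ler_pM2r ?invr_gt0//.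
    rewrite -[leLHS]mulrA [leRHS]mulrAC.
    by apply: ler_pM => //; rewrite mulr_ge0// ltW.
  apply: (@le_trans _ _ (Num.sqrt (CK * Q * ((q * q) ^+ s) ^+ 2) * (a * s.+1%:R))).
    by apply: ler_wpM2r => //; exact: ler_wsqrtr.
  have Q0 : 0 <= Q.
    by rewrite /Q !mulr_ge0 ?powR_ge0//; exact: pseries_sum_ge0.
  rewrite (sqrtrM _ (mulr_ge0 CK0 Q0)) (sqrtrM _ CK0) sqrtr_sqr ger0_norm; last first.
    by rewrite exprn_ge0// mulr_ge0//; case/andP: q01.
  rewrite le_eqVlt; apply/orP; left; apply/eqP; ring.
have -> : a * Num.sqrt CK * (1 - q)^-1 ^+ 2 * Num.sqrt Q =
  a * Num.sqrt CK * Num.sqrt Q * (1 - q)^-1 ^+ 2 by ring.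
apply: (@le_trans _ _ (a * Num.sqrt CK * Num.sqrt Q *
    \sum_(0 <= s < S) s.+1%:R * (q * q) ^+ s)); last first.
  by rewrite ler_wpM2l ?sum_natmul_geometric_le// !mulr_ge0 ?sqrtr_ge0.
elim: S => [|S IH]; first by rewrite /dyadic !big_geq// mulr0.
rewrite (@big_cat_nat _ _ _ (dyadic S)) ?leq_dyadic//= [X in _ <= _ * X]big_nat_recr//=.
by rewrite mulrDr; apply: lerD; [exact: IH|exact: block].
Qed.

(** * The number of classes, from the gap condition *)

Definition class_count (R : realType) (phi : R -> R) (s : nat) : nat :=
  (Num.truncn (phi (2 ^ s.+1)%:R)).+1.

(** Up to index [2 ^ s.+1] each step multiplies [theta] by at least [1 + 1 / P] with
    [P = phi (2 ^ s.+1)], so [i] steps multiply it by at least [1 + i / P], as in Bernoulli's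
    inequality. [class_count] exceeds [P]. *)
Lemma gap_doubling (R : realType) (theta : nat -> nat) (phi : R -> R) (s n : nat) :
  (forall n, (0 < theta n)%N) ->
  {in `[0, +oo[ &, {homo phi : x y / x <= y}} ->
  (forall n : nat, 0 < phi n%:R) ->
  (forall n : nat, 1 + 1 / phi n%:R <= (theta n.+1)%:R / (theta n)%:R) ->
  (n + class_count phi s < dyadic s.+1)%N ->
  (2 * theta n <= theta (n + class_count phi s))%N.
Proof.
move=> t0 hphi phi0 gap nK; set P := phi (2 ^ s.+1)%:R.
have P0 : 0 < P by exact: phi0.
have tp k : 0 < (theta k)%:R :> R by rewrite ltr0n.
have iter i : (n + i <= 2 ^ s.+1)%N ->
    (theta n)%:R * (1 + i%:R / P) <= (theta (n + i)%N)%:R :> R.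
  elim: i => [_|i IH ni]; first by rewrite addn0 mul0r addr0 mulr1.
  have {}IH := IH (leq_trans (leq_add (leqnn n) (leqnSn i)) ni).
  have pi_le : phi (n + i)%N%:R <= P.
    apply: hphi; rewrite ?in_itv/= ?andbT// ler_nat.
    by rewrite (leq_trans _ ni)// leq_add2l.
  have := gap (n + i)%N; rewrite ler_pdivlMr ?tp// addnS.
  apply: le_trans.
  apply: (@le_trans _ _ ((1 + P^-1) * (theta (n + i)%N)%:R)); last first.
    rewrite ler_wpM2r ?(ltW (tp _))// lerD2l mul1r lef_pV2 ?posrE//.
  apply: (@le_trans _ _ ((1 + P^-1) * ((theta n)%:R * (1 + i%:R / P)))); last first.
    by rewrite ler_wpM2l// addr_ge0// invr_ge0 ltW.
  rewrite mulrCA ler_wpM2l ?(ltW (tp _))//.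
  have -> : (1 + P^-1) * (1 + i%:R / P) =
      1 + i.+1%:R / P + P^-1 * (i%:R / P) by rewrite -natr1; ring.
  by rewrite lerDl mulr_ge0 ?divr_ge0 ?invr_ge0// ltW.
rewrite -(ler_nat R) natrM mulrC; apply: le_trans (iter _ _); last first.
  by rewrite (leq_trans (ltnW nK))// /dyadic leq_pred.
rewrite ler_wpM2l ?(ltW (tp _))// -[2]/(1 + 1) lerD2l ler_pdivlMr// mul1r.
by apply: ltW; exact: truncnS_gt.
Qed.

Lemma gamma_powR_bound (R : realType) (phi : R -> R) (delta kappa : R) :
  (gamma phi <= delta%:E)%E -> delta < kappa ->
  exists M : R, 1 <= M /\ forall x, M < x -> phi x <= x `^ kappa.
Proof.
move=> gd dk.
have : (gamma phi < kappa%:E)%E by rewrite (le_lt_trans gd)// lte_fin.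
move=> /ereal_inf_lt[_ [V VF <-] hV].
have [M [_ HM]] := VF.
(* Beyond 1 the logarithm of [x] is positive, so the bound on the quotient can be multiplied out. *)
exists (Num.max M 1); split; first by rewrite le_max lexx orbT.
move=> x; rewrite gt_max => /andP[Mx x1].
have x0 : 0 < x by rewrite (lt_trans ltr01).
have lnx : 0 < ln x by rewrite ln_gt0.
have : ((ln (phi x) / ln x)%:E < kappa%:E)%E.
  by apply: le_lt_trans hV; apply: ereal_sup_ubound; exists x => //; exact: HM.
rewrite lte_fin ltr_pdivrMr// => lnphi.
have [p0|p0] := ltP 0 (phi x); last by rewrite (le_trans p0)// powR_ge0.
rewrite -ler_ln ?posrE ?powR_gt0// ln_powR; exact: ltW.
Qed.

Lemma class_count_le (R : realType) (phi : R -> R) (delta kappa : R) :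
  (forall n : nat, 0 < phi n%:R) ->
  (gamma phi <= delta%:E)%E -> delta < kappa -> 0 <= kappa <= 1 ->
  exists2 CK : R, 0 <= CK &
    forall s, (class_count phi s)%:R <= CK * (2 `^ kappa) ^+ s.
Proof.
move=> phi0 gd dk /andP[k0 k1].
have [M [M1 hM]] := gamma_powR_bound gd dk.
pose s0 := (Num.truncn M).+1.
have t1 : 1 <= 2 `^ kappa :> R.
  by rewrite -[leLHS](powRr0 (2 : R)) ler_powR// ler1n.
have t2 : 2 `^ kappa <= 2 :> R by rewrite ler1_powR// ler1n.
pose C1 : R := \sum_(i < s0) (class_count phi i)%:R.
have C10 : 0 <= C1 by apply: sumr_ge0.
(* In 3, a 2 bounds the factor [2 ^ kappa] due to the argument [2 ^ s.+1] and a 1 pays for the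
   successor in [class_count]; [C1] covers the finitely many early blocks. *)
exists (3 + C1); first by rewrite addr_ge0.
move=> s; have ts : 1 <= (2 `^ kappa) ^+ s :> R by rewrite exprn_ege1.
have [ss0|s0s] := ltnP s s0.
  apply: (@le_trans _ _ C1); last first.
    apply: (@le_trans _ _ (3 + C1)); first by rewrite lerDr.
    by rewrite ler_peMr// addr_ge0.
  by rewrite /C1 (bigD1 (Ordinal ss0))//= lerDl; apply: sumr_ge0.
have Ms : M < (2 ^ s.+1)%:R.
  apply: lt_le_trans (truncnS_gt M) _; rewrite ler_nat.
  apply: leq_trans s0s _; apply: ltnW; apply: (leq_trans (ltn_expl s (isT : 1 < 2)%N)).
  by rewrite leq_exp2l.
rewrite /class_count -natr1.
have p1 : (Num.truncn (phi (2 ^ s.+1)%:R))%:R <= phi (2 ^ s.+1)%:R.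
  by have /andP[] := truncn_itv (ltW (phi0 (2 ^ s.+1)%N)).
have := hM _ Ms; rewrite powR_expn2 exprS => p2.
have : 2 `^ kappa * 2 `^ kappa ^+ s <= 2 * 2 `^ kappa ^+ s :> R.
  by rewrite ler_wpM2r// (le_trans ler01).
have : 0 <= C1 * 2 `^ kappa ^+ s by rewrite mulr_ge0// (le_trans ler01).
rewrite mulrDl; lra.
Qed.

(** * From complex values to real cosine sums *)

(** The range [[0, 8)] contains a full turn because [pi < 4], and its integer length suits the grid
    of angles. The angle is [acos (x / s)] in the closed upper half plane and its reflection
    below. *)
Lemma polar_exists (R : realType) (x y : R) :
  exists2 psi, 0 <= psi < 8 &
    x = Num.sqrt (x ^+ 2 + y ^+ 2) * cos psi /\
    y = Num.sqrt (x ^+ 2 + y ^+ 2) * sin psi.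
Proof.
set s := Num.sqrt _.
have n0 : 0 <= x ^+ 2 + y ^+ 2 by rewrite addr_ge0// sqr_ge0.
have s2 : s ^+ 2 = x ^+ 2 + y ^+ 2 by rewrite sqr_sqrtr.
have [s0|s0] := eqVneq s 0.
  have xy0 : x ^+ 2 + y ^+ 2 = 0 by rewrite -s2 s0 expr0n.
  have x0 : x = 0.
    apply/eqP; rewrite -sqrf_eq0 eq_le sqr_ge0 andbT -xy0 lerDl; exact: sqr_ge0.
  have y0 : y = 0.
    apply/eqP; rewrite -sqrf_eq0 eq_le sqr_ge0 andbT -xy0 lerDr; exact: sqr_ge0.
  by exists 0; rewrite ?lexx ?ltr0n// s0 !mul0r x0 y0.
have sp : 0 < s by rewrite lt0r s0 sqrtr_ge0.
have xs : -1 <= x / s <= 1.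
  rewrite -ler_norml normrM normfV (gtr0_norm sp) ler_pdivrMr// mul1r.
  by rewrite -sqrtr_sqr ler_wsqrtr// lerDl sqr_ge0.
have cosx : cos (acos (x / s)) = x / s by rewrite acosK// in_itv.
have sinx : sin (acos (x / s)) = `|y| / s.
  rewrite sin_acos// (_ : 1 - (x / s) ^+ 2 = (y / s) ^+ 2).
    by rewrite sqrtr_sqr normrM normfV (gtr0_norm sp).
  by rewrite !expr_div_n s2; field; rewrite -s2 sqrf_eq0.
have p1 : 0 <= acos (x / s) by rewrite acos_ge0.
have p2 : acos (x / s) <= pi by rewrite acos_lepi.
have pi4 : pi < 4 :> R by have /andP[_] := @pihalf_02 R; lra.
have [y0|y0] := leP 0 y.
  exists (acos (x / s)); first by rewrite p1/=; lra.
  by rewrite cosx sinx ger0_norm// ![s * _]mulrC !divfK.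
exists (pi *+ 2 - acos (x / s)).
  have pi0 := pi_ge0 R; apply/andP; split; rewrite mulr2n; lra.
rewrite addrC cosD2pi sinD2pi cosN sinN cosx sinx ltr0_norm//.
by split; field.
Qed.

Section complex_glue.
Context {R : realType}.
Implicit Types (z w : R[i]) (x y : R).

Lemma cmodE z : cmod z = Num.sqrt (complex.Re z ^+ 2 + complex.Im z ^+ 2).
Proof. by rewrite /cmod normc_def. Qed.

Lemma cmod_ge0 z : 0 <= cmod z.
Proof. by rewrite cmodE sqrtr_ge0. Qed.

Lemma norm_cmod z : `|z| = (cmod z)%:C.
Proof. by rewrite cmodE normc_def. Qed.

Lemma cmodM z w : cmod (z * w) = cmod z * cmod w.
Proof. by apply: complexI; rewrite -norm_cmod normrM !norm_cmod -rmorphM. Qed.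

Lemma cmodX z n : cmod (z ^+ n) = cmod z ^+ n.
Proof. by apply: complexI; rewrite -norm_cmod normrX norm_cmod -rmorphXn. Qed.

Lemma cmod_real x : cmod x%:C = `|x|.
Proof. by rewrite cmodE /= expr0n addr0 sqrtr_sqr. Qed.

Lemma cmod_le_Re_Im z : cmod z <= `|complex.Re z| + `|complex.Im z|.
Proof.
rewrite cmodE -[leRHS]ger0_norm ?addr_ge0// -sqrtr_sqr ler_wsqrtr//.
rewrite sqrrD !real_normK ?num_real// [leRHS]addrAC lerDl.
by rewrite mulrn_wge0// mulr_ge0.
Qed.

Lemma expiD x y : expi (x + y) = expi x * expi y.
Proof.
by apply/eqP; rewrite eq_complex /= cosD sinD [cos x * sin y + _]addrC !eqxx.
Qed.

Lemma expiX x n : expi x ^+ n = expi (n%:R * x).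
Proof.
elim: n => [|n IH]; last by rewrite exprS IH -expiD -natr1 mulrDl mul1r addrC.
by apply/eqP; rewrite expr0 mul0r eq_complex /= cos0 sin0 !eqxx.
Qed.

Lemma polar_complex z : exists2 psi, 0 <= psi < 8 & z = (cmod z)%:C * expi psi.
Proof.
have [psi psi8 [h1 h2]] := polar_exists (complex.Re z) (complex.Im z).
exists psi => //; apply/eqP; rewrite eq_complex /= !mul0r subr0 addr0.
by rewrite cmodE -h1 -h2 !eqxx.
Qed.

Lemma cvg_complex (u : nat -> R[i]^o) x y :
  (fun n => complex.Re (u n)) @ \oo --> x ->
  (fun n => complex.Im (u n)) @ \oo --> y ->
  u @ \oo --> (x +i* y : R[i]^o).
Proof.
move=> ux uy; apply/cvgrPdist_lt => e e0.
have eE : e = (complex.Re e)%:C.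
  by apply/eqP; rewrite eq_complex /= eqxx; move: e0; rewrite ltcE => /andP[].
have e0' : 0 < complex.Re e by move: e0; rewrite ltcE => /andP[].
near=> n; rewrite eE norm_cmod ltcR.
apply: le_lt_trans (cmod_le_Re_Im _) _.
have -> : complex.Re ((x +i* y : R[i]) - u n) = x - complex.Re (u n).
  by case: (u n).
have -> : complex.Im ((x +i* y : R[i]) - u n) = y - complex.Im (u n).
  by case: (u n).
have hx : `|x - complex.Re (u n)| < complex.Re e / 2.
  by near: n; move/cvgrPdist_lt : ux; apply; rewrite divr_gt0.
have hy : `|y - complex.Im (u n)| < complex.Re e / 2.
  by near: n; move/cvgrPdist_lt : uy; apply; rewrite divr_gt0.
lra.
Unshelve. all: by end_near. Qed.

Lemma Re_sum (I : Type) (s : seq I) (P : pred I) (g : I -> R[i]) :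
  complex.Re (\sum_(i <- s | P i) g i) = \sum_(i <- s | P i) complex.Re (g i).
Proof.
by apply: (big_morph (@complex.Re R) (op1 := +%R) (id1 := 0)) => // -[? ?] [].
Qed.

Lemma Im_sum (I : Type) (s : seq I) (P : pred I) (g : I -> R[i]) :
  complex.Im (\sum_(i <- s | P i) g i) = \sum_(i <- s | P i) complex.Im (g i).
Proof.
by apply: (big_morph (@complex.Im R) (op1 := +%R) (id1 := 0)) => // -[? ?] [].
Qed.

End complex_glue.

Lemma cvg_le_dyadic (R : realType) (u : nat -> R) (x B : R) :
  u @ \oo --> x -> (forall S, u (dyadic S) <= B) -> x <= B.
Proof.
move=> ux uB; rewrite leNgt; apply/negP => Bx.
have [N _ hN] := cvgr_gt x ux _ Bx.
have := hN (dyadic N); rewrite /= ltNge uB => /(_ _)/negP; apply => //.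
by rewrite -ltnS dyadicK ltn_expl.
Qed.

(** Convergence at the real point [rho] makes the terms tend to zero: they are eventually below 1,
    and the finitely many others are bounded by their sum. *)
Lemma disc_analytic_unit_radius (R : realType) (a : nat -> R[i]) (f : R[i] -> R[i]) :
  disc_analytic a f -> unit_radius (fun n => cmod (a n)).
Proof.
move=> af rho /andP[r0 r1].
have zr : cmod (rho%:C) = rho by rewrite cmod_real gtr0_norm.
have cv := af rho%:C; rewrite zr in cv; have {}cv := cv r1.
have /cvgr0Pnorm_lt /(_ 1 ltr01) [N _ hN] := cvg_series_cvg_0 (cvgP _ cv).
pose C := \sum_(i < N) cmod (a i) * rho ^+ i.
have t0 i : 0 <= cmod (a i) * rho ^+ i.
  by rewrite mulr_ge0 ?cmod_ge0// exprn_ge0// ltW.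
have C0 : 0 <= C by apply: sumr_ge0.
exists (C + 1) => n; rewrite ger0_norm ?cmod_ge0//.
have [nN|Nn] := ltnP n N.
  apply: (@le_trans _ _ C); last by rewrite lerDl.
  by rewrite /C (bigD1 (Ordinal nN))//= lerDl; apply: sumr_ge0.
have := hN n Nn; rewrite /power_terms norm_cmod -[1]/((1 : R)%:C) ltcR.
rewrite cmodM cmodX zr => /ltW h.
by apply: le_trans h _; rewrite lerDr.
Qed.

Lemma disc_analytic_nonzero (R : realType) (a : nat -> R[i]) (f : R[i] -> R[i]) :
  disc_analytic a f -> (exists z, cmod z < 1 /\ f z <> 0) ->
  exists n, 0 < cmod (a n).
Proof.
move=> af [z [z1 fz]]; apply: contrapT => noa; apply: fz.
have a0 n : a n = 0.
  apply/eqP; rewrite -normr_eq0 norm_cmod -[0]/((0 : R)%:C).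
  apply/eqP; congr (_ %:C); apply/eqP; rewrite eq_le cmod_ge0 andbT leNgt.
  by apply/negP => an; apply: noa; exists n.
have cv := af z z1.
have : series (power_terms a z) = fun=> 0.
  by apply/funext => n; rewrite /series /= big1// => i _; rewrite /power_terms a0 mul0r.
move=> s0; rewrite s0 in cv.
exact: (cvg_unique (@norm_hausdorff _ _) cv (cvg_cst (0 : R[i]^o))).
Qed.

Lemma max_term_ge (R : realType) (a : nat -> R[i]) (r : R) n :
  unit_radius (fun n => cmod (a n)) -> 0 < r < 1 ->
  cmod (a n) * r ^+ n <= max_term a r.
Proof.
move=> ua r01; have [C hC] := ua r r01; apply: ub_le_sup; last by exists n.
exists C => _ [k _ <-]; have := hC k; rewrite ger0_norm//; exact: cmod_ge0.
Qed.

(** The modulus is at most [|Re| + |Im|], and the phases [d * pi / 2], [d = 0, 1, 2, 3], turn the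
    cosine sum into [Re], [- Im], [- Re], [Im]. One-sided bounds at the four phases therefore
    suffice, and dyadic partial sums determine the limits. *)
Lemma rotated_sum_le (R : realType) (a : nat -> R[i]) (theta : nat -> nat)
    (alpha : nat -> R) (r t psi B : R) :
  unit_radius (fun n => cmod (a n)) -> 0 < r < 1 ->
  (forall n, a n = (cmod (a n))%:C * expi (alpha n)) ->
  (forall S d, (d < 4)%N -> \sum_(0 <= n < dyadic S) cmod (a n) * r ^+ n *
     cos ((theta n)%:R * t + (n%:R * psi + alpha n + d%:R * (pi / 2))) <= B) ->
  cmod (rotated_sum a theta t (r%:C * expi psi)) <= B + B.
Proof.
move=> ua r01 aE hB; have /andP[r0 r1] := r01.
pose c n := cmod (a n) * r ^+ n.
pose g n := (theta n)%:R * t + (n%:R * psi + alpha n).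
have c0 n : 0 <= c n by rewrite mulr_ge0 ?cmod_ge0// exprn_ge0// ltW.
have termE n : power_terms (rotated_coef a theta t) (r%:C * expi psi) n =
    (c n)%:C * expi (g n).
  rewrite /power_terms /rotated_coef {1}aE exprMn expiX -rmorphXn /c /g rmorphM.
  by rewrite !expiD /=; ring.
have cc : cvgn (series c).
  have <- : (fun i => `|cmod (a i)| * `|r| ^+ i) = c.
    by apply/funext => n; rewrite /c ger0_norm ?cmod_ge0// gtr0_norm.
  by apply: unit_radius_cvg => //; rewrite gtr0_norm.
have ac (k : nat -> R) : (forall n, `|k n| <= 1) -> cvgn (series (fun n => c n * k n)).
  move=> k1; apply: normed_cvg; apply: series_le_cvg cc => n /=; [exact: normr_ge0|exact: c0|].
  by rewrite normrM (ger0_norm (c0 n)) ler_piMr.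
have c1 : cvgn (series (fun n => c n * cos (g n))) by apply: ac => n; exact: cos_max.
have c2 : cvgn (series (fun n => c n * sin (g n))) by apply: ac => n; exact: sin_max.
set x := limn _ in c1; set y := limn _ in c2.
have cz : series (power_terms (rotated_coef a theta t) (r%:C * expi psi)) @ \oo -->
    (x +i* y : R[i]^o).
  apply: cvg_complex.
    suff <- : series (fun n => c n * cos (g n)) = (fun n => complex.Re (series
      (power_terms (rotated_coef a theta t) (r%:C * expi psi)) n)) by exact: c1.
    apply/funext => n; rewrite /series /= Re_sum; apply: eq_bigr => i _.
    by rewrite termE /= mul0r subr0.
  suff <- : series (fun n => c n * sin (g n)) = (fun n => complex.Im (series
    (power_terms (rotated_coef a theta t) (r%:C * expi psi)) n)) by exact: c2.
  apply/funext => n; rewrite /series /= Im_sum; apply: eq_bigr => i _.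
  by rewrite termE /= mul0r addr0.
have -> : rotated_sum a theta t (r%:C * expi psi) = x +i* y.
  by rewrite /rotated_sum; apply: (cvg_lim (@norm_hausdorff _ _) cz).
apply: le_trans (cmod_le_Re_Im _) _ => /=.
have gE n d : (theta n)%:R * t + (n%:R * psi + alpha n + d%:R * (pi / 2)) =
    g n + d%:R * (pi / 2) by rewrite /g; ring.
have hB' d : (d < 4)%N -> forall S,
    \sum_(0 <= n < dyadic S) c n * cos (g n + d%:R * (pi / 2)) <= B.
  move=> d4 S; have := hB S d d4; congr (_ <= _).
  by apply: eq_bigr => n _; rewrite gE.
have nc (u : nat -> R) : cvgn (series u) ->
    (fun n => - series u n) @ \oo --> - limn (series u).
  by move=> cu; apply: cvgN.
rewrite lerD// ler_norml; apply/andP; split.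
- rewrite lerNl; apply: (cvg_le_dyadic (nc _ c1)) => S.
  have := hB' 2 isT S; rewrite /series /= -sumrN; congr (_ <= _).
  apply: eq_bigr => n _; have -> : g n + 2%:R * (pi / 2) = g n + pi by field.
  by rewrite cosDpi mulrN.
- apply: (cvg_le_dyadic c1) => S.
  have := hB' 0 isT S; congr (_ <= _).
  by apply: eq_bigr => n _; rewrite mul0r addr0.
- rewrite lerNl; apply: (cvg_le_dyadic (nc _ c2)) => S.
  have := hB' 1 isT S; rewrite /series /= -sumrN; congr (_ <= _).
  by apply: eq_bigr => n _; rewrite mul1r cosDpihalf mulrN.
- apply: (cvg_le_dyadic c2) => S.
  have := hB' 3 isT S; congr (_ <= _).
  apply: eq_bigr => n _; have -> : g n + 3%:R * (pi / 2) = (g n + pi / 2) + pi by field.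
  by rewrite cosDpi cosDpihalf opprK.
Qed.

Lemma max_modulus_le (R : realType) (a : nat -> R[i]) (theta : nat -> nat)
    (alpha : nat -> R) (r t B : R) :
  unit_radius (fun n => cmod (a n)) -> 0 < r < 1 ->
  (forall n, a n = (cmod (a n))%:C * expi (alpha n)) ->
  (forall psi, 0 <= psi < 8 -> forall S d, (d < 4)%N ->
     \sum_(0 <= n < dyadic S) cmod (a n) * r ^+ n *
     cos ((theta n)%:R * t + (n%:R * psi + alpha n + d%:R * (pi / 2))) <= B) ->
  max_modulus a theta r t <= B + B.
Proof.
move=> ua r01 aE hB; have /andP[r0 _] := r01.
apply: ge_sup.
  exists (cmod (rotated_sum a theta t r%:C)), r%:C => //=.
  by rewrite cmod_real gtr0_norm.
move=> _ [z /= zr <-]; have [psi psi8 ->] := polar_complex z; rewrite zr.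
by apply: rotated_sum_le => // S d d4; exact: hB.
Qed.

(** * Logarithmic inequalities for the mean, the variance and the majorant *)

Lemma ln_le_id (R : realType) (x : R) : 0 < x -> ln x <= x.
Proof.
by move=> x0; rewrite -[leRHS]expRK ler_ln ?posrE ?expR_gt0//;
  apply: le_trans (expR_ge1Dx x); rewrite lerDr.
Qed.

(** [ln y <= y] at [y = e * x]; used to absorb iterated logarithms in a small multiple of a
    logarithm. *)
Lemma ln_le_linear (R : realType) (e x : R) : 0 < e -> 0 < x ->
  ln x <= e * x - ln e.
Proof.
move=> e0 x0; have := ln_le_id (mulr_gt0 e0 x0); rewrite lnM ?posrE//; lra.
Qed.

(** For [x = expR w] this is the square of [w / 2 <= expR (w / 2)]. *)
Lemma sqr_ln_le (R : realType) (x : R) : 1 <= x -> ln x ^+ 2 <= 4 * x.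
Proof.
move=> x1; have x0 : 0 < x by lra.
rewrite -{2}(lnK x0); set w := ln x; have w0 : 0 <= w by exact: ln_ge0.
have -> : expR w = expR (w / 2) ^+ 2 by rewrite expr2 -expRD -splitr.
have : w / 2 <= expR (w / 2) by have := expR_ge1Dx (w / 2); lra.
rewrite -(@ler_sqr R) ?nnegrE ?expR_ge0//; last by lra.
by rewrite expr_div_n => ?; lra.
Qed.

Lemma expR1_bounds (R : realType) : 2 <= (expR 1 : R) <= 4.
Proof.
have e1 : 2 <= expR 1 :> R by have := expR_ge1Dx (1 : R); lra.
have hq := @expR_le_quadratic R 2^-1 (lexx _).
have e12 : expR 1 = expR 2^-1 ^+ 2 :> R.
  by rewrite expr2 -expRD; congr expR; field.
have : expR 2^-1 ^+ 2 <= 2 ^+ 2 :> R.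
  by rewrite ler_sqr ?nnegrE ?expR_ge0//; lra.
by rewrite e1 e12 /= => ?; lra.
Qed.

Lemma ln_ge1 (R : realType) (x : R) : expR 1 <= x -> 1 <= ln x.
Proof.
move=> ex; rewrite -(expRK 1) ler_ln ?posrE ?expR_gt0//.
exact: lt_le_trans (expR_gt0 1) ex.
Qed.

Lemma ln_natS_le (R : realType) n : ln n.+1%:R <= n%:R :> R.
Proof.
have : -1 < n%:R :> R by rewrite (lt_le_trans (ltrN10 R)).
by move=> /le_ln1Dx; rewrite -natr1 addrC.
Qed.

Lemma ln1D_le_mul (R : realType) (h B x : R) : 1 <= h -> 1 <= B -> 0 <= x ->
  x <= h * B -> ln (1 + x) <= 1 + ln h + ln B.
Proof.
move=> h1 B1 x0 xB; have h0 : 0 < h by lra.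
have B0 : 0 < B by lra.
have hB : 1 <= h * B by rewrite -[1]mulr1 ler_pM.
have : ln (1 + x) <= ln (2 * (h * B)) by rewrite ler_ln ?posrE//; lra.
rewrite lnM ?posrE//; last by rewrite mulr_gt0.
rewrite lnM ?posrE//; have := @ln_natS_le R 1; lra.
Qed.

Lemma mulr_sqr_ln_bounds (R : realType) (e u : R) : 0 < e -> expR 1 <= u ->
  1 <= u * ln u ^+ 2 /\ ln (u * ln u ^+ 2) <= (1 + e) * ln u + `|2 * ln (e / 2)|.
Proof.
move=> e0 eu; have lu := ln_ge1 eu; have /andP[e2 _] := expR1_bounds R.
have u0 : 0 < u by lra.
have lu0 : 0 < ln u by lra.
split.
  have l2 : 1 <= ln u ^+ 2 by rewrite exprn_ege1.
  by rewrite -[1]mulr1 ler_pM//; lra.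
rewrite lnM ?posrE ?exprn_gt0// lnXn// [ln (ln u) *+ 2]mulr2n.
have e20 : 0 < e / 2 by lra.
have := ln_le_linear e20 lu0.
have := ler_norm (- (2 * ln (e / 2))); rewrite normrN; lra.
Qed.

Lemma mulr_sqr_ln_le (R : realType) (u : R) : 1 <= u ->
  u * ln u ^+ 2 <= 4 * u ^+ 2.
Proof.
move=> hu; have -> : 4 * u ^+ 2 = u * (4 * u) by ring.
by rewrite ler_wpM2l ?sqr_ln_le//; lra.
Qed.

(** Replaces [u * ln u ^+ 2] by [4 * u ^+ 2]: crude in the exponent but with absolute constants,
    which is enough to close the loop in [ln_majorant_le]. *)
Lemma ln1D_le_sqr (R : realType) (h x u : R) : 1 <= h -> expR 1 <= u -> 0 <= x ->
  x <= h * (u * ln u ^+ 2) -> ln (1 + x) <= 1 + ln h + (3 + 2 * ln u).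
Proof.
move=> h1 eu x0 hx; have /andP[e2 _] := expR1_bounds R.
have u1 : 1 <= u by lra.
have u0 : 0 < u by lra.
have U1 : 1 <= 4 * u ^+ 2 by have := exprn_ege1 2 u1; lra.
have q : x <= h * (4 * u ^+ 2).
  by apply: le_trans hx _; rewrite ler_wpM2l ?mulr_sqr_ln_le//; lra.
apply: le_trans (ln1D_le_mul h1 U1 x0 q) _.
rewrite lnM ?posrE ?exprn_gt0// lnXn// [ln _ *+ 2]mulr2n.
have := @ln_natS_le R 3; lra.
Qed.

Lemma ln_mean_shift_le (R : realType) (A : R) : 0 <= A ->
  ln (expR 1 + A) <= 2 + ln (1 + A).
Proof.
move=> A0; have /andP[e2 _] := expR1_bounds R; have A1 : 0 < 1 + A by lra.
have : ln (expR 1 + A) <= ln (expR 1 * (1 + A)).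
  rewrite ler_ln ?posrE ?mulr_gt0 ?expR_gt0//; last by lra.
  rewrite mulrDr mulr1 lerD2l ler_peMl//; lra.
by rewrite lnM ?posrE ?expR_gt0// expRK; lra.
Qed.

(* V bounds F, F bounds A and A bounds V; the loop closes because the bound of ln F by V
   is only logarithmic. *)
Lemma ln_majorant_le (R : realType) (C0 h mu A V F : R) :
  0 <= C0 -> 1 <= h -> 0 < mu -> - C0 <= ln mu -> 1 <= F -> 0 <= A -> 0 <= V ->
  A <= h * ((expR 1 + ln F) * ln (expR 1 + ln F) ^+ 2) ->
  V <= h * ((expR 1 + A) * ln (expR 1 + A) ^+ 2) ->
  ln F <= ln mu + C0 + ln (1 + V) / 2 ->
  3 * C0 + 40 <= ln (h * mu) ->
  expR 1 + ln F <= 4 * ln (h * mu).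
Proof.
move=> C00 h1 mu0 lmu F1 A0 V0 hA hV hF.
have /andP[e2 e4] := expR1_bounds R; have lnF0 := ln_ge0 F1.
have lA : ln (1 + A) <= 1 + ln h + (3 + 2 * ln (expR 1 + ln F)).
  by apply: ln1D_le_sqr hA => //; rewrite lerDl.
have lV : ln (1 + V) <= 1 + ln h + (3 + 2 * ln (expR 1 + A)).
  by apply: ln1D_le_sqr hV => //; rewrite lerDl.
have lu2 := ln_mean_shift_le A0.
have H0 : 0 <= ln h by exact: ln_ge0.
have u0 : 0 < expR 1 + ln F by lra.
(* The three bounds combine to one on [ln F] containing [2 * ln (expR 1 + ln F)]. Slope 1/8 turns
   this into a quarter of [expR 1 + ln F], which the left side absorbs. *)
have e8 : 0 < 8^-1 :> R by rewrite invr_gt0.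
have l1 := ln_le_linear e8 u0.
have l8 : - ln 8^-1 <= 7 :> R by rewrite lnV ?posrE// opprK; exact: ln_natS_le.
rewrite lnM ?posrE//; last by lra.
move: lA lV lu2 l1 l8 hF lnF0 H0 e4 lmu C00; clear.
set u := ln (expR 1 + ln F); set v := ln (expR 1 + A); lra.
Qed.

(** Put [H = ln h], [Y = ln (ln (h * mu))]. As [ln (expR 1 + ln F) <= Y + 3], the hypothesis on A
    gives [ln (1 + A) <= H + (1 + e) Y] and then that on V gives
    [ln (1 + V) <= (2 + e) H + (1 + e)^2 Y], up to constants. *)
Lemma mean_variance_log_bounds (R : realType) (C0 e : R) : 0 < e -> 0 <= C0 ->
  exists C : R, 1 <= C /\ forall h mu A V F : R,
    1 <= h -> 0 < mu -> - C0 <= ln mu -> 1 <= F -> 0 <= A -> 0 <= V ->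
    A <= h * ((expR 1 + ln F) * ln (expR 1 + ln F) ^+ 2) ->
    V <= h * ((expR 1 + A) * ln (expR 1 + A) ^+ 2) ->
    ln F <= ln mu + C0 + ln (1 + V) / 2 ->
    C <= ln (h * mu) ->
    ln (1 + A) <= C + (1 + e) * (2 * ln h + ln (ln (h * mu))) /\
    ln (1 + V) <= C + (1 + e) ^+ 2 * (2 * ln h + ln (ln (h * mu))).
Proof.
move=> e0 C00; pose Ce := `|2 * ln (e / 2)|.
(* The additive constants of both estimates, plus the threshold of [ln_majorant_le]. *)
pose C := 1 + Ce + (1 + e) * (3 + Ce) + 3 * (1 + e) ^+ 2 + (3 * C0 + 40).
have Ce0 : 0 <= Ce by exact: normr_ge0.
have eCe : 0 <= (1 + e) * (3 + Ce) by rewrite mulr_ge0//; lra.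
have ee : 1 + e <= (1 + e) ^+ 2 by rewrite expr2 ler_peMl//; lra.
have CC : 3 * C0 + 40 <= C by rewrite /C; lra.
exists C; split; first by lra.
move=> h mu A V F h1 mu0 lmu F1 A0 V0 hA hV hF hC.
have lnF0 : 0 <= ln F by exact: ln_ge0.
have u1_le := ln_majorant_le C00 h1 mu0 lmu F1 A0 V0 hA hV hF (le_trans CC hC).
have [u1e u2e] : expR 1 <= expR 1 + ln F /\ expR 1 <= expR 1 + A.
  by rewrite !lerDl.
have [B1 b1] := mulr_sqr_ln_bounds e0 u1e.
have [B2 b2] := mulr_sqr_ln_bounds e0 u2e.
have lA := le_trans (ln1D_le_mul h1 B1 A0 hA) (lerD (lexx _) b1).
have lV := le_trans (ln1D_le_mul h1 B2 V0 hV) (lerD (lexx _) b2).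
have lnu2 := ln_mean_shift_le A0.
rewrite -/Ce in lA lV; have H0 : 0 <= ln h by exact: ln_ge0.
have X1 : 1 <= ln (h * mu) by apply: le_trans hC; lra.
have Y0 : 0 <= ln (ln (h * mu)) by exact: ln_ge0.
have X0 : 0 < ln (h * mu) by exact: lt_le_trans X1.
have lu1Y : ln (expR 1 + ln F) <= 3 + ln (ln (h * mu)).
  have : ln (expR 1 + ln F) <= ln (4 * ln (h * mu)).
    by rewrite ler_ln ?posrE// ?mulr_gt0// (lt_le_trans (expR_gt0 1)).
  by rewrite lnM ?posrE// => /le_trans; apply; rewrite lerD2r; exact: ln_natS_le.
move: (ln h) (ln (ln _)) H0 Y0 lA lV lu1Y => H Y H0 Y0 lA lV lu1Y.
move: lnu2 lA lV lu1Y; move: (ln (expR 1 + ln F)) (ln (expR 1 + A)) => p q.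
move: (ln (1 + A)) (ln (1 + V)) => x y qx xp yq pY.
have e1 : 0 <= 1 + e by lra.
have eH : 0 <= e * H by rewrite mulr_ge0// ltW.
have h5 : (1 + e) * H <= (1 + e) ^+ 2 * H by rewrite ler_wpM2r.
have ep : (1 + e) * p <= (1 + e) * (3 + Y) by rewrite ler_wpM2l.
have lx : x <= 1 + H + (1 + e) * (3 + Y) + Ce by lra.
have eq : (1 + e) * q <= (1 + e) * (2 + (1 + H + (1 + e) * (3 + Y) + Ce)).
  by rewrite ler_wpM2l//; lra.
split.
  have -> : (1 + e) * (2 * H + Y) = (2 * H + 2 * (e * H)) + (1 + e) * Y by ring.
  rewrite mulrDr in lx; rewrite /C.
  clear - lx H0 eH Ce0 eCe ee C00; lra.
have -> : (1 + e) ^+ 2 * (2 * H + Y) =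
  (1 + e) ^+ 2 * H + (1 + e) ^+ 2 * H + (1 + e) ^+ 2 * Y by ring.
have eqE : (1 + e) * (2 + (1 + H + (1 + e) * (3 + Y) + Ce)) =
  (1 + e) * (3 + Ce) + (1 + e) * H + 3 * (1 + e) ^+ 2 + (1 + e) ^+ 2 * Y by ring.
have h6 : H <= (1 + e) * H by rewrite mulrDl mul1r lerDl.
rewrite /C; clear - yq eq eqE h5 h6 C00; lra.
Qed.

(** * The maximum modulus in terms of the maximal term, mean and majorant *)

(** [K s <= CK * 2 ^ s] and the grid size is at most [4 ^ s.+1]; the numerical factors 2, 8, 4 and 4
    make up [2 ^ 8]. *)
Lemma grid_weight_le (R : realType) (K : nat -> nat) (CK kappa : R) s :
  0 <= CK -> 0 <= kappa <= 1 ->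
  (K s)%:R <= CK * (2 `^ kappa) ^+ s ->
  (grid_weight dyadic K s)%:R <= 2 ^+ 8 * CK * 16 ^+ s.
Proof.
move=> CK0 /andP[k0 k1] hK.
have K2 : (K s)%:R <= CK * 2 ^+ s.
  apply: le_trans hK _; rewrite ler_wpM2l// lerXn2r ?nnegrE ?powR_ge0//.
  by rewrite ler1_powR// ler1n.
have D4 : (grid_size dyadic s)%:R <= 4 ^+ s.+1 :> R.
  rewrite -natrX ler_nat /grid_size /dyadic -[4%N]/(2 ^ 2)%N -expnM mulnC expnM.
  have : (0 < 2 ^ s.+1)%N by rewrite expn_gt0.
  by case: (2 ^ s.+1)%N => // n _ /=; rewrite ltn_exp2r.
rewrite /grid_weight !natrM.
have -> : 2 ^+ 8 * CK * 16 ^+ s = 2 ^+ s.+1 * ((CK * 2 ^+ s) * (8 * 4 ^+ s.+1) * 4).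
  rewrite (exprS 2 s) (exprS 4 s) (_ : 16 ^+ s = 2 ^+ s * 2 ^+ s * 4 ^+ s :> R).
    by ring.
  by rewrite -!exprMn; congr (_ ^+ _); ring.
rewrite natrX ler_pM2l ?exprn_gt0// ler_pM2r//.
by apply: ler_pM => //; rewrite ler_pM2l.
Qed.

(** The weight grows geometrically in [s], so the union bound costs only a factor linear in [s],
    which [lacunary_sum_bound] tolerates. *)
Lemma ln_grid_weight_le (R : realType) (K : nat -> nat) (CK kappa : R) :
  0 <= CK -> 0 <= kappa <= 1 ->
  (forall s, (K s)%:R <= CK * (2 `^ kappa) ^+ s) ->
  exists2 a : R, 0 <= a & forall s x, 0 <= x ->
    2 * ln (1 + (grid_weight dyadic K s)%:R * x) + 1 <=
      a * (1 + ln (1 + x)) * s.+1%:R.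
Proof.
move=> CK0 k01 hK; pose Q := 2 ^+ 8 * CK.
have Q0 : 0 <= Q by rewrite mulr_ge0// exprn_ge0.
have hw s : (grid_weight dyadic K s)%:R <= Q * 16 ^+ s := grid_weight_le CK0 k01 (hK s).
clearbody Q; pose C := ln (1 + Q) + 16.
have C0 : 0 <= C by rewrite /C addr_ge0// ln_ge0// lerDl.
exists (2 * C + 3); first by lra.
move=> s x x0; have := hw s; set w := (grid_weight _ _ _)%:R => ww.
have w0 : 0 <= w by [].
have l1 : ln (1 + w * x) <= ln (1 + w) + ln (1 + x).
  rewrite -lnM ?posrE; [|lra|lra].
  have wx : 0 <= w * x by rewrite mulr_ge0.
  rewrite ler_ln ?posrE; [|lra|by rewrite mulr_gt0//; lra].
  by rewrite mulrDl mul1r mulrDr mulr1; lra.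
have l2 : ln (1 + w) <= C * s.+1%:R.
  have p16 : 1 <= 16 ^+ s :> R by rewrite exprn_ege1// ler1n.
  apply: (@le_trans _ _ (ln ((1 + Q) * 16 ^+ s))).
    rewrite ler_ln ?posrE; [|lra|by rewrite mulr_gt0//; lra].
    by rewrite mulrDl mul1r; lra.
  rewrite lnM ?posrE; [|lra|lra].
  rewrite lnXn//.
  have : ln 16 <= 16 :> R by exact: ln_le_id.
  have : 0 <= ln (1 + Q) by rewrite ln_ge0//; lra.
  set L := ln (1 + _); set l16 := ln 16 => L0 h16.
  rewrite /C -/L -natr1 -mulr_natl.
  have : s%:R * l16 <= s%:R * 16 by rewrite ler_wpM2l.
  have : 0 <= L * s%:R by rewrite mulr_ge0.
  by rewrite mulrDr mulrDl; lra.
have lx : 0 <= ln (1 + x) by rewrite ln_ge0//; lra.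
have s1 : 1 <= s.+1%:R :> R by rewrite ler1n.
set S := s.+1%:R in l2 s1 *; set X := ln (1 + x) in l1 lx *.
have e1 : 0 <= C * S * X by rewrite !mulr_ge0//; lra.
have e2 : X <= X * S by rewrite ler_peMr.
have -> : (2 * C + 3) * (1 + X) * S = 2 * (C * S) + 2 * (C * S * X) + 3 * S + 3 * (X * S) by ring.
lra.
Qed.

(** The logarithm of [M <= C (1 + ln (1 + x)) sqrt (mu (1 + A)^tau F)], which follows from the class
    bounds summed over classes and blocks; [x] stands for [h r]. *)
Lemma levy_log_bound (R : realType) (a : nat -> R[i]) (theta : nat -> nat)
    (alpha c : nat -> R) (phi : R -> R) (delta tau C0 : R) :
  unit_radius (fun n => cmod (a n)) ->
  (forall n, a n = (cmod (a n))%:C * expi (alpha n)) ->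
  (forall k, cmod (a k) <= c k) -> 1 <= c 0 -> unit_radius c ->
  (forall n : nat, 0 < phi n%:R) -> (gamma phi <= delta%:E)%E ->
  0 <= delta -> delta < tau -> tau <= 1 -> 0 <= C0 ->
  exists2 C : R, 0 <= C & forall r t x, 0 < r < 1 -> 0 <= x ->
    0 < max_term a r -> - C0 <= ln (max_term a r) ->
    (forall s j d psi, (j < class_count phi s)%N -> (d < 4)%N -> 0 <= psi < 8 ->
      class_sum theta (fun n => cmod (a n)) alpha
        (residue_block dyadic (class_count phi) s j) (dyadic s.+1) r t psi
        (d%:R * (pi / 2)) <=
      Num.sqrt (class_energy (fun n => cmod (a n))
        (residue_block dyadic (class_count phi) s j) (dyadic s.+1) r) *
        (2 * ln (1 + (grid_weight dyadic (class_count phi) s)%:R * x) + 1)) ->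
    ln (max_modulus a theta r t) - ln (max_term a r) <=
      C + ln (1 + ln (1 + x)) + tau / 2 * ln (1 + ps_mean c r) +
      (ln (limn (pseries c r)) - ln (max_term a r)) / 2.
Proof.
move=> ua aE ac c01 uc phi0 gd d0 dt t1 C00.
(* Strictly between the two: [delta < kappa] bounds the class count and [kappa < tau] gives
   geometric decay over the blocks. *)
pose kappa := (delta + tau) / 2.
have dk : delta < kappa by rewrite /kappa; lra.
have kt : kappa < tau by rewrite /kappa; lra.
have k01 : 0 <= kappa <= 1 by apply/andP; split; rewrite /kappa; lra.
have [CK CK0 hK] := class_count_le phi0 gd dk k01.
have [b b0 hb] := ln_grid_weight_le CK0 k01 hK.
set q := 2 `^ ((kappa - tau) / 4) : R.
pose G := 2 * (b * Num.sqrt CK * (1 - q)^-1 ^+ 2 * Num.sqrt 2).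
have G0 : 0 <= G.
  have g1 : 0 <= (1 - q)^-1 ^+ 2 by exact: sqr_ge0.
  by rewrite /G mulr_ge0// mulr_ge0 ?sqrtr_ge0// mulr_ge0// mulr_ge0 ?sqrtr_ge0.
exists (`|ln (1 + G)| + C0); first by rewrite addr_ge0.
move=> r t x r01 x0 mu0 lmu hlevy; have /andP[r0 r1] := r01.
have r01' : 0 <= r < 1 by rewrite ltW.
set mu := max_term a r in mu0 lmu *; set A := ps_mean c r; set F := limn _.
have c0 k : 0 <= c k := le_trans (cmod_ge0 (a k)) (ac k).
have F1 : 1 <= F by exact: pseries_sum_ge1.
have A0 : 0 <= A by exact: ps_mean_ge0.
have lA : 0 <= ln (1 + A) by rewrite ln_ge0//; lra.
have lF : 0 <= ln F by exact: ln_ge0.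
have lx : 0 <= ln (1 + x) by rewrite ln_ge0//; lra.
have llx : 0 <= ln (1 + ln (1 + x)) by rewrite ln_ge0//; lra.
have tA : 0 <= tau / 2 * ln (1 + A) by rewrite mulr_ge0//; lra.
have nG : 0 <= `|ln (1 + G)| by [].
(* [ln] is 0 at nonpositive arguments; the lower bound on [ln mu] then suffices. *)
have [M0|M0] := leP (max_modulus a theta r t) 0.
  by rewrite ln0//; lra.
have P0 : 0 < (1 + A) `^ tau by rewrite powR_gt0//; lra.
have F0 : 0 < F by lra.
have MB : max_modulus a theta r t <=
    (1 + G) * (1 + ln (1 + x)) * Num.sqrt (mu * (1 + A) `^ tau * F).
  pose B := b * (1 + ln (1 + x)) * Num.sqrt CK * (1 - q)^-1 ^+ 2 *
    Num.sqrt (2 * mu * (1 + A) `^ tau * F).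
  apply: (@le_trans _ _ (B + B)).
    apply: (max_modulus_le (alpha := alpha)) => // psi psi8 S d d4.
    apply: (@lacunary_sum_bound _ _ _ _ c (class_count phi) _ _ _ _ _ _ CK kappa) => //.
    - by move=> k; exact: cmod_ge0.
    - by move=> k; exact: max_term_ge.
    - by apply/andP; split; lra.
    - by rewrite mulr_ge0//; lra.
    - move=> s j jK; apply: le_trans (hlevy s j d psi jK d4 psi8) _.
      by rewrite ler_wpM2l ?sqrtr_ge0// hb.
  have -> : B + B = G * (1 + ln (1 + x)) * Num.sqrt (mu * (1 + A) `^ tau * F).
    rewrite /B /G -[2 * mu * _]mulrA -[2 * (mu * _) * F]mulrA sqrtrM//; ring.
  by rewrite ler_wpM2r ?sqrtr_ge0// ler_wpM2r; lra.
have S0 : 0 < mu * (1 + A) `^ tau * F by rewrite !mulr_gt0.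
have : ln (max_modulus a theta r t) <=
    ln ((1 + G) * (1 + ln (1 + x)) * Num.sqrt (mu * (1 + A) `^ tau * F)).
  by rewrite ler_ln ?posrE//; exact: lt_le_trans MB.
rewrite !lnM ?posrE ?sqrtr_gt0//; [|lra..|by rewrite mulr_gt0//; lra].
rewrite -(powR12_sqrt (ltW S0)) ln_powR !lnM ?posrE//; last by rewrite mulr_gt0.
rewrite ln_powR; have := ler_norm (ln (1 + G)).
lra.
Qed.

(** * Assembly of the exceptional sets and the final estimate *)

Lemma integral_setU_lty (R : realType) (h : R -> R) (A B : set R) :
  {in `]0, 1[, forall r, 0 < h r} ->
  measurable_fun (`]0, 1[%classic : set R) h ->
  measurable A -> measurable B -> A `<=` `]0, 1[ -> B `<=` `]0, 1[ ->
  (\int[lebesgue_measure]_(r in A) (h r)%:E < +oo)%E ->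
  (\int[lebesgue_measure]_(r in B) (h r)%:E < +oo)%E ->
  (\int[lebesgue_measure]_(r in A `|` B) (h r)%:E < +oo)%E.
Proof.
move=> h0 mh mA mB AI BI fA fB.
have hI (D : set R) : D `<=` `]0, 1[ -> forall r, D r -> (0 <= (h r)%:E)%E.
  by move=> DI r /DI /h0 /ltW; rewrite lee_fin.
have mhI (D : set R) : measurable D -> D `<=` `]0, 1[ ->
    measurable_fun D (fun r => (h r)%:E).
  by move=> mD DI; apply/measurable_EFinP; exact: measurable_funS mh.
have mD : measurable (B `\` A) by exact: measurableD.
have DI : B `\` A `<=` `]0, 1[ by move=> r [/BI].
have UI : A `|` (B `\` A) `<=` `]0, 1[ by move=> r [/AI//|/DI].
have -> : A `|` B = A `|` (B `\` A).
  apply/seteqP; split => [r [Ar|Br]|r [Ar|[Br _]]]; [by left| |by left|by right].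
  by have [Ar|nAr] := pselect (A r); [left|right].
rewrite ge0_integral_setU//.
- rewrite lte_add_pinfty//; apply: le_lt_trans fB.
  apply: ge0_subset_integral; [exact: mD|exact: mB|exact: mhI|exact: hI|].
  by move=> r [].
- by apply: mhI => //; exact: measurableU.
- exact: hI.
- by apply/disj_setPS => r [Ar [_ nAr]].
Qed.

(** [wiman_exceptional] is applied to [expR 1 + ln F], of derivative [A / r], and to [expR 1 + A],
    of derivative [V / r]; since [r < 1], these dominate A and V. *)
Lemma wiman_valiron_exceptional (R : realType) (h : R -> R) (c : nat -> R) :
  {in `]0, 1[, forall r, 0 < h r} ->
  measurable_fun (`]0, 1[%classic : set R) h ->
  (forall k, 0 <= c k) -> 1 <= c 0 -> unit_radius c ->
  exists E : set R, [/\ measurable E, E `<=` `]0, 1[,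
    (\int[lebesgue_measure]_(r in E) (h r)%:E < +oo)%E &
    forall r, r \in `]0, 1[ -> ~ E r ->
      let u1 := expR 1 + ln (limn (pseries c r)) in
      let u2 := expR 1 + ps_mean c r in
      ps_mean c r <= h r * (u1 * ln u1 ^+ 2) /\
      r * ps_mean_diff c r <= h r * (u2 * ln u2 ^+ 2)].
Proof.
move=> h0 mh c0 c01 uc.
have I01 (r : R) : r \in `]0, 1[ -> [/\ 0 < r < 1, 0 <= r < 1 & `|r| < 1].
  rewrite in_itv/= => /[dup] r01 /andP[r0 r1].
  by rewrite r01 (ltW r0) r1 gtr0_norm.
pose F r := limn (pseries c r); pose F1 r := limn (pseries (pseries_diffs c) r).
have ud := unit_radius_diffs uc.
have un := unit_radius_natmul uc.
have d0 k : 0 <= pseries_diffs c k by rewrite mulr_ge0.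
have Fge (r : R) : r \in `]0, 1[ -> 1 <= F r.
  by move=> /I01[_ r01 _]; exact: pseries_sum_ge1.
have Fn0 (r : R) : r \in `]0, 1[ -> F r != 0.
  by move=> /Fge F1r; rewrite gt_eqF// (lt_le_trans ltr01).
have cps (e : nat -> R) : unit_radius e ->
    {in `]0, 1[, continuous (fun r => limn (pseries e r))}.
  move=> ue r /I01[_ _ nr1]; have d := is_derive_pseries ue nr1.
  apply/differentiable_continuous/derivable1_diffP; exact: ex_derive.
have du1 : {in `]0, 1[, forall r : R, is_derive r (1 : R)
    (fun r => expR 1 + ln (F r)) ((F r)^-1 * F1 r)}.
  move=> r r01; have [_ _ nr1] := I01 _ r01.
  have dF : is_derive r (1 : R) F (F1 r) := is_derive_pseries uc nr1.
  have F0 : 0 < F r by rewrite (lt_le_trans ltr01)// Fge.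
  have d1 := @is_derive1_comp _ (@ln R) F _ _ _ (is_derive1_ln F0) dF.
  have := is_deriveD (is_derive_cst (expR 1 : R) r (1 : R)) d1.
  by congr is_derive; rewrite add0r.
have cu1 : {in `]0, 1[, continuous (fun r => (F r)^-1 * F1 r)}.
  move=> r r01; apply: cvgM; last exact: cps.
  by apply: cvgV; [exact: Fn0|exact: cps].
have pu1 : {in `]0, 1[, forall r : R, 0 <= (F r)^-1 * F1 r}.
  move=> r r01; have [_ r01' _] := I01 _ r01.
  rewrite mulr_ge0 ?invr_ge0 ?(le_trans ler01 (Fge _ r01))//.
  exact: pseries_sum_ge0.
have eu1 : {in `]0, 1[, forall r : R, expR 1 <= expR 1 + ln (F r)}.
  by move=> r r01; rewrite lerDl ln_ge0// Fge.
have du2 : {in `]0, 1[, forall r : R, is_derive r (1 : R)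
    (fun r => expR 1 + ps_mean c r) (ps_mean_diff c r)}.
  move=> r r01; have [_ r01' _] := I01 _ r01.
  have := is_deriveD (is_derive_cst (expR 1 : R) r (1 : R))
    (is_derive_ps_mean c0 c01 uc r01').
  by congr is_derive; rewrite add0r.
have cu2 : {in `]0, 1[, continuous (ps_mean_diff c)}.
  move=> r r01; apply: cvgM.
    apply: cvgB; apply: cvgM; try exact: cps.
    by apply: cps => //; exact: unit_radius_diffs.
  apply: cvgV; first by rewrite expf_neq0// Fn0.
  by apply: cvgM; exact: cps.
have pu2 : {in `]0, 1[, forall r : R, 0 <= ps_mean_diff c r}.
  by move=> r /I01[r01 _ _]; exact: ps_mean_diff_ge0.
have eu2 : {in `]0, 1[, forall r : R, expR 1 <= expR 1 + ps_mean c r}.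
  by move=> r /I01[_ r01 _]; rewrite lerDl ps_mean_ge0.
have [mE1 iE1] := wiman_exceptional h0 mh du1 cu1 pu1 eu1.
have [mE2 iE2] := wiman_exceptional h0 mh du2 cu2 pu2 eu2.
set E1 : set R := _ `&` _ in mE1 iE1; set E2 : set R := _ `&` _ in mE2 iE2.
have E1I : E1 `<=` `]0, 1[ by move=> r [].
have E2I : E2 `<=` `]0, 1[ by move=> r [].
exists (E1 `|` E2); split.
- exact: measurableU.
- by move=> r [/E1I|/E2I].
- apply: integral_setU_lty => //.
    by apply: le_lt_trans iE1 _; exact: ltry.
  by apply: le_lt_trans iE2 _; exact: ltry.
move=> r r01 nE u1 u2; have [r01' r01'' nr1] := I01 _ r01.
have /andP[r0 /ltW r1] := r01'.
split.
- have : (F r)^-1 * F1 r <= h r * (u1 * ln u1 ^+ 2).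
    by rewrite leNgt; apply/negP => hE; apply: nE; left; split.
  apply: le_trans; rewrite /ps_mean (pseries_natmul_sum uc nr1) -/(F r) -/(F1 r).
  rewrite -mulrA mulrC [X in X * r]mulrC ler_piMr//; exact: pu1.
- have : ps_mean_diff c r <= h r * (u2 * ln u2 ^+ 2).
    by rewrite leNgt; apply/negP => hE; apply: nE; right; split.
  apply: le_trans; rewrite mulrC ler_piMr//; exact: pu2.
Qed.

Lemma ln_pseries_sum_le (R : realType) (b mu V F : R) :
  0 < b -> 0 < mu -> 0 <= V -> 0 < F ->
  F <= 2 * (mu * b) * (2 * Num.sqrt (2 * (V + 1)) + 1) ->
  ln F <= ln mu + ln (8 * b) + ln (1 + V) / 2.
Proof.
move=> b0 mu0 V0 F0 hF; set S := Num.sqrt (1 + V).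
have S1 : 1 <= S by rewrite -[leLHS]sqrtr1 ler_wsqrtr// lerDl.
(* [sqrt 2 <= 3 / 2] and [1 <= S] bound the last factor by [4 * S], whence the constant 8. *)
have s2 : Num.sqrt 2 <= 3 / 2 :> R.
  rewrite -[leRHS]ger0_norm; last by lra.
  by rewrite -sqrtr_sqr ler_wsqrtr//; lra.
have s2S : Num.sqrt 2 * S <= 3 / 2 * S by rewrite ler_wpM2r//; lra.
have lS : ln S = 2^-1 * ln (1 + V) by rewrite /S -powR12_sqrt ?ln_powR//; lra.
have : ln F <= ln ((8 * b) * (mu * S)).
  rewrite ler_ln ?posrE//; last by rewrite !mulr_gt0//; lra.
  apply: le_trans hF _.
  have -> : 8 * b * (mu * S) = 2 * (mu * b) * (4 * S) by ring.
  rewrite ler_wpM2l//; first by rewrite mulr_ge0// mulr_ge0// ltW.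
  by rewrite sqrtrM// [V + 1]addrC -/S; lra.
have b8 : 0 < 8 * b by rewrite mulr_gt0.
have Sp : 0 < S by lra.
have mS : 0 < mu * S by rewrite mulr_gt0.
by rewrite (lnM b8 mS) (lnM mu0 Sp) lS; lra.
Qed.

Lemma ln_ln1D_le (R : realType) (e h : R) : 0 < e -> 1 <= h ->
  ln (1 + ln (1 + h)) <= e * ln h + (2 * e + `|ln e|).
Proof.
move=> e0 h1; have H0 : 0 <= ln h by exact: ln_ge0.
have l2 : ln 2 <= 1 :> R.
  by have := @le_ln1Dx R 1 (lt_trans (ltrN10 R) ltr01).
have l1 : ln (1 + h) <= 1 + ln h.
  have : ln (1 + h) <= ln (2 * h) by rewrite ler_ln ?posrE//; lra.
  rewrite lnM ?posrE//; lra.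
have l0 : 0 <= ln (1 + h) by rewrite ln_ge0//; lra.
have := ler_norm (- ln e); rewrite normrN => le.
apply: (@le_trans _ _ (ln (2 + ln h))); first by rewrite ler_ln ?posrE//; lra.
apply: le_trans (ln_le_linear e0 _) _; first by lra.
rewrite mulrDr; lra.
Qed.

(* [1/4 + delta/2 <= (1 + 3 delta) / (4 + 2 delta)] on [0, 1/2]. *)
Lemma exponent_le (R : realType) (delta : R) : 0 <= delta < 1 / 2 ->
  4^-1 + delta / 2 <= (1 + 3 * delta) / (4 + 2 * delta).
Proof.
move=> /andP[d0 d1]; rewrite ler_pdivlMr; last by lra.
have : 0 <= delta * (1 - 2 * delta) by rewrite mulr_ge0//; lra.
lra.
Qed.

Lemma log_ratio_bound (R : realType) (delta eps e C0 C1 C2 T h mu A V F M : R) :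
  0 <= delta < 1 / 2 -> 0 < e -> e <= eps / 8 -> e <= 4^-1 ->
  0 <= C0 -> 0 <= C1 -> 1 <= C2 ->
  T = C1 + (2 * e + `|ln e|) + C2 + C0 + C2 ->
  0 <= ln h -> 0 < h -> T / e <= ln h -> 0 < mu -> C2 <= ln (h * mu) -> 0 <= A ->
  ln (1 + A) <= C2 + (1 + e) * (2 * ln h + ln (ln (h * mu))) ->
  ln (1 + V) <= C2 + (1 + e) ^+ 2 * (2 * ln h + ln (ln (h * mu))) ->
  ln F <= ln mu + C0 + ln (1 + V) / 2 ->
  M - ln mu <= C1 + ln (1 + ln (1 + h)) + (delta + e) / 2 * ln (1 + A) +
    (ln F - ln mu) / 2 ->
  (M - ln mu) / (2 * ln h + ln (ln (h * mu))) <= 4^-1 + delta / 2 + eps.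
Proof.
move=> /andP[d0 d1] e0 e8 e4 C00 C10 C21 TE H0 h0 hT mup C2h A0.
have h1 : 1 <= h by rewrite -[h]lnK ?posrE// -expR0 ler_expR.
have := ln_ln1D_le e0 h1.
set H := ln h in H0 hT *; set Y := ln (ln _); set L := 2 * H + Y.
have Y0 : 0 <= Y by rewrite ln_ge0//; lra.
have T1 : 1 <= T by rewrite TE; have : 0 <= `|ln e| by []; lra.
have HL : H <= L by rewrite /L; lra.
have TeL : T <= e * L by rewrite mulrC -ler_pdivrMr//; lra.
have L0 : 0 < L.
  by rewrite -(pmulr_rgt0 _ e0); lra.
have eHL : e * H <= e * L by rewrite ler_wpM2l// ltW.
clearbody L; set LL := ln (1 + ln (1 + h)) => lln bA bV bF bM.
rewrite ler_pdivrMr//.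
have tA : (delta + e) / 2 * ln (1 + A) <= (delta + e) / 2 * (C2 + (1 + e) * L).
  by rewrite ler_wpM2l//; lra.
have tC : (delta + e) / 2 * C2 <= C2 by rewrite ler_piMl//; lra.
(* Of the two [e], one absorbs the iterated logarithm of [h] and the other the constants [T]; the
   remaining terms come from A and from V, the latter entering through F. *)
apply: (@le_trans _ _ ((e + e + (delta + e) / 2 * (1 + e) + 4^-1 * (1 + e) ^+ 2) * L)).
  apply: le_trans bM _.
  have -> : (e + e + (delta + e) / 2 * (1 + e) + 4^-1 * (1 + e) ^+ 2) * L =
    e * L + e * L + (delta + e) / 2 * ((1 + e) * L) + 4^-1 * ((1 + e) ^+ 2 * L) by ring.
  rewrite [_ * (C2 + _)]mulrDr in tA.
  set q1 := _ / 2 * ((1 + e) * L) in tA *; set q2 := (1 + e) ^+ 2 * L in bV *.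
  clear - lln eHL TeL TE tA tC bV bF C21 C00; lra.
rewrite ler_wpM2r ?(ltW L0)//.
have et : (delta + e) * e <= e by rewrite ler_piMl//; lra.
have ee : e * e <= e by rewrite ler_piMl//; lra.
rewrite sqrrD expr1n mul1r [e *+ 2]mulr2n expr2.
have -> : (delta + e) / 2 * (1 + e) = delta / 2 + e / 2 + ((delta + e) * e) / 2 by field.
clear - et ee e8 e0; lra.
Qed.

Theorem corollary3p5 (R : realType) (h : R -> R) (a : nat -> R[i])
    (f : R[i] -> R[i]) (theta : nat -> nat) (phi : R -> R) (delta : R) :
  class_H h ->
  disc_analytic a f ->
  (exists z : R[i], cmod z < 1 /\ f z <> 0) ->
  (forall n, (0 < theta n)%N) ->
  class_L phi ->
  (forall n : nat, 0 < phi n%:R) ->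
  (forall n : nat, 1 + 1 / phi n%:R <= (theta n.+1)%:R / (theta n)%:R) ->
  0 <= delta < 1 / 2 ->
  gamma phi = limn_esup (fun n : nat =>
    (1 / ln n%:R *
      ln ((theta n)%:R / ((theta n.+1)%:R - (theta n)%:R)) : R)%:E) ->
  (gamma phi <= delta%:E)%E ->
  {ae lebesgue_measure, forall t : R, exists E : set R,
    [/\ measurable E,
        E `<=` `]0, 1[,
        (\int[lebesgue_measure]_(r in E) (h r)%:E < +oo)%E &
        (limf_esup
          (fun r => ((ln (max_modulus a theta r t) - ln (max_term a r)) /
             (2 * ln (h r) + ln (ln (h r * max_term a r))))%:E)
          (within (~` E) 1^'-)
         <= ((1 + 3 * delta) / (4 + 2 * delta))%:E)%E]}.
Proof.
move=> [h0 ch _ hy _] af anz t0 [_ phimono _] phip gap /andP[d0 d12] _ gd.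
have mh : measurable_fun (`]0, 1[%classic : set R) h.
  apply: open_continuous_measurable_fun; first exact: interval_open.
  by move=> r; rewrite inE/= => r01; exact: ch.
have ua := disc_analytic_unit_radius af.
have [n0 an0] := disc_analytic_nonzero af anz.
have [alpha aE] : {alpha : nat -> R & forall n, a n = (cmod (a n))%:C * expi (alpha n)}.
  apply: (@choice _ _ (fun n al => a n = (cmod (a n))%:C * expi al)) => n.
  by have [al _ anE] := polar_complex (a n); exists al.
(* Adding 1 to the constant term forces [1 <= F], so [ln F] is nonnegative. *)
pose c k := cmod (a k) + (k == 0)%:R.
have ac k : cmod (a k) <= c k by rewrite lerDl.
have c0 k : 0 <= c k := le_trans (cmod_ge0 (a k)) (ac k).
have c01 : 1 <= c 0 by rewrite /c eqxx lerDr cmod_ge0.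
have uc : unit_radius c.
  move=> rho r01; have [C hC] := ua _ r01; exists (C + 1) => n.
  have /andP[/ltW r0 /ltW r1] := r01.
  rewrite ger0_norm// /c mulrDl; apply: lerD.
    by have := hC n; rewrite ger0_norm// cmod_ge0.
  by case: n => [|n]; rewrite ?mul1r ?mul0r// exprn_ile1.
pose K := class_count phi.
have tK s n : (dyadic s <= n)%N -> (n + K s < dyadic s.+1)%N ->
    (2 * theta n <= theta (n + K s))%N.
  by move=> _ nK; exact: (gap_doubling t0 phimono phip gap nK).
have [E1 [mE1 E1I iE1 hE1]] := wiman_valiron_exceptional h0 mh c0 c01 uc.
have := @levy_exceptional R h theta (fun n => cmod (a n)) alpha dyadic K h0 mh t0
  (fun k => cmod_ge0 (a k)) (fun s => ltn0Sn _) tK.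
apply: (@filterS _ _ (ae_filter_ringOfSetsType lebesgue_measure)) => t.
(* The set is fixed before [eps] is introduced; only the neighbourhood of 1 will depend on [eps]. *)
move=> [E0 [mE0 E0I iE0 hE0]]; exists (E0 `|` E1); split.
- exact: measurableU.
- by move=> r [/E0I|/E1I].
- exact: integral_setU_lty.
apply/lee_addgt0Pr => eps eps0; rewrite -EFinD.
pose e := Num.min (eps / 8) (4^-1).
have e0 : 0 < e by rewrite lt_min; apply/andP; split; clear - eps0; lra.
have e8 : e <= eps / 8 by rewrite ge_min lexx.
have e4 : e <= 4^-1 by rewrite ge_min lexx orbT.
have dt : delta < delta + e by rewrite ltrDl.
have t1 : delta + e <= 1 by clear - d12 e4; lra.
(* A lower bound for the maximal term on [[1/2, 1)], from one nonzero coefficient. *)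
pose mu0 := cmod (a n0) * 2^-1 ^+ n0.
have mu00 : 0 < mu0 by rewrite mulr_gt0// exprn_gt0// invr_gt0.
pose C0 := `|ln (8 * (1 + mu0^-1))| + `|ln mu0|.
have C00 : 0 <= C0 by rewrite addr_ge0.
have [C1 C10 hC1] := levy_log_bound theta ua aE ac c01 uc phip gd d0 dt t1 C00.
have [C2 [C21 hC2]] := mean_variance_log_bounds e0 C00.
pose T := C1 + (2 * e + `|ln e|) + C2 + C0 + C2.
have T0 : 0 <= T.
  rewrite /T !addr_ge0//; [|exact: le_trans C21..].
  by rewrite mulr_ge0// ltW.
have Te0 : 0 <= T / e by rewrite divr_ge0// ltW.
set beta := (1 + 3 * delta) / (4 + 2 * delta).
have beta_ge : 4^-1 + delta / 2 <= beta by apply: exponent_le; rewrite d0.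
apply: ge_ereal_inf.
set g := (fun r : R => _%:E).
exists (ereal_sup (g @` [set r | (g r <= (beta + eps)%:E)%E])); last first.
  by apply: ge_ereal_sup => _ [r /= gr <-].
(* The upper limit is an infimum over the members of the filter, so one set on which the quotient is
   at most [beta + eps] suffices. *)
exists [set r | (g r <= (beta + eps)%:E)%E] => //.
rewrite /within /=; near=> r => nE.
have r1 : r < 1 by near: r; exact: nbhs_left_lt.
have r2 : 2^-1 < r.
  by near: r; apply: nbhs_left_gt; rewrite invf_lt1// ltr1n.
have r0 : 0 < r by rewrite (lt_trans _ r2)// invr_gt0.
(* This size of [h r] yields both [T / e <= ln (h r)] and, with [- C0 <= ln mu],
   [C2 <= ln (h r * mu)]. *)
have hr : expR (C2 + C0 + T / e) <= h r by near: r; move/cvgryPge : hy; apply.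
have r01 : 0 < r < 1 by rewrite r0.
have rI : r \in `]0, 1[ by rewrite in_itv.
have [nE0 nE1] : ~ E0 r /\ ~ E1 r by split => ?; apply: nE; [left|right].
have [hA hV] := hE1 r rI nE1.
have r01' : 0 <= r < 1 by rewrite ltW.
have A0 : 0 <= ps_mean c r by exact: ps_mean_ge0.
have V0 : 0 <= r * ps_mean_diff c r by rewrite mulr_ge0 ?ps_mean_diff_ge0// ltW.
have F1 : 1 <= limn (pseries c r) by exact: pseries_sum_ge1.
have muge : mu0 <= max_term a r.
  apply: le_trans (max_term_ge n0 ua r01); rewrite ler_wpM2l ?(ltW an0)//.
  by rewrite lerXn2r ?nnegrE ?invr_ge0// ltW.
have mup : 0 < max_term a r by exact: lt_le_trans muge.
have lmu : - C0 <= ln (max_term a r).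
  apply: (@le_trans _ _ (ln mu0)); last by rewrite ler_ln.
  rewrite lerNl; have := ler_norm (- ln mu0); rewrite normrN => lmu0.
  by apply: le_trans lmu0 _; rewrite /C0 lerDr.
have hp : 0 < h r by exact: h0.
have hH : C2 + C0 + T / e <= ln (h r).
  by rewrite -(expRK (C2 + C0 + T / e)) ler_ln ?posrE ?expR_gt0.
have Hm0 : 0 <= C2 + C0 + T / e by rewrite !addr_ge0// (le_trans _ C21).
have h1 : 1 <= h r by rewrite (le_trans _ hr)// -expR0 ler_expR.
have lFV : ln (limn (pseries c r)) <=
    ln (max_term a r) + C0 + ln (1 + r * ps_mean_diff c r) / 2.
  have m1 : 0 < 1 + mu0^-1 by rewrite addr_gt0// invr_gt0.
  (* The 1 added at index 0 is at most [mu / mu0]. *)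
  have hm k : c k * r ^+ k <= max_term a r * (1 + mu0^-1).
    have mm : 1 <= max_term a r * mu0^-1 by rewrite ler_pdivlMr// mul1r.
    have hk := max_term_ge k ua r01.
    rewrite /c mulrDl mulrDr mulr1; apply: lerD => //; apply: le_trans mm.
    by case: k {hk} => [|k]; rewrite ?mul1r ?mul0r// exprn_ile1// ltW.
  have FF := pseries_sum_le_max_term c0 c01 uc r01 hm.
  apply: le_trans (ln_pseries_sum_le m1 mup V0 (lt_le_trans ltr01 F1) FF) _.
  rewrite lerD2r lerD2l (le_trans (ler_norm _))// lerDl; exact: normr_ge0.
have C2h : C2 <= ln (h r * max_term a r).
  rewrite lnM ?posrE//; clear - hH lmu Te0; lra.
have [bA bV] := hC2 _ _ _ _ _ h1 mup lmu F1 A0 V0 hA hV lFV C2h.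
have lM : ln (max_modulus a theta r t) - ln (max_term a r) <=
    C1 + ln (1 + ln (1 + h r)) + (delta + e) / 2 * ln (1 + ps_mean c r) +
    (ln (limn (pseries c r)) - ln (max_term a r)) / 2.
  by apply: hC1 => //; [exact: ltW|move=> s j d psi; exact: hE0].
rewrite /g /= lee_fin; apply: le_trans (_ : _ <= 4^-1 + delta / 2 + eps) _; last first.
  by rewrite lerD2r.
apply: (log_ratio_bound _ e0 e8 e4 C00 C10 C21 erefl _ hp _ mup C2h A0 bA bV lFV lM).
- by rewrite d0.
- exact: le_trans hH.
- by apply: le_trans hH; rewrite lerDr addr_ge0// (le_trans _ C21).
Unshelve. all: by end_near. Qed.
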